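(* Suppose $(b,\mathbf l)$ and $(c,\mathbf m)$ are two Bäcklund transforms of the same twist to a principal contact element net $(a,\mathbf k)$. Then there exists a unique principal contact element net $(d,\mathbf n)$ which is at the same time a Bäcklund transform of $(b,\mathbf l)$ and $(c,\mathbf m)$.
   Context: A contact element is a pair $(p,\mathbf n)$ of a point $p\in E^3$ (Euclidean three-space) and a unit vector $\mathbf n\in\mathbb R^3$. Its normal line is the oriented line through $p$ in direction $\mathbf n$; its oriented tangent plane is the plane through $p$ with oriented normal vector $\mathbf n$. A contact element net is a map $(p,\mathbf n)$ from $\mathbb Z^s$, $s\ge 2$, to the space of contact elements; its value at $i\in\mathbb Z^s$ is written $(p_i,\mathbf n_i)$. It is a principal contact element net if any two neighbouring contact elements $(p_i,\mathbf n_i)$ and $(p_j,\mathbf n_j)$ have a common oriented tangent sphere (so their normal lines meet in a point at the same oriented distance from $p_i$ and $p_j$). Two principal contact element nets $(p,\mathbf n)$ and $(q,\mathbf m)$ are called Bäcklund mates, and $(q,\mathbf m)$ is then called a Bäcklund transform of $(p,\mathbf n)$, if: (1) the distance of corresponding points $p_i$ and $q_i$ is constant; (2) the angle of corresponding normals $\mathbf n_i$ and $\mathbf m_i$ is constant, measured consistently in counter-clockwise direction when viewed along the ray from $p_i$ to $q_i$; (3) two corresponding tangent planes intersect in the connecting line $p_i\vee q_i$ of their points. The twist of two oriented lines $N$ and $M$ is $\sin\varphi/\delta$, where $\varphi$ is the angle between their direction vectors (measured according to the convention in (2), along the common perpendicular) and $\delta$ is the distance between $N$ and $M$. The twist of two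 Bäcklund mates is the twist of any two corresponding normal lines. Standing genericity assumptions: the involved geometric entities are implicitly assumed generic. Specifically, the Gaussian curvature of every elementary quadrilateral $(p_0,\mathbf n_0),\dots,(p_3,\mathbf n_3)$ of a principal contact element net is well-defined; it is the ratio $S_0/S$ of the oriented area $S_0$ of the quadrilateral $\mathbf n_0,\mathbf n_1,\mathbf n_2,\mathbf n_3$ to the oriented area $S$ of the circular quadrilateral $p_0,p_1,p_2,p_3$. Moreover, corresponding elementary quadrilaterals of Bäcklund mates give four positions $A_0,\dots,A_3$ (direct Euclidean displacements) of a rigid figure consisting of two corresponding contact elements, with neighbouring positions related by a rotation; it is assumed that the four relative revolute axes in the moving space, $\{x: A_i(x)=A_{i+1}(x)\}$ (indices mod 4), have two transversal lines (in algebraic sense) and that neighbouring relative revolute axes are skew.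
   Formalization: (d,n) is required to differ from (a,k) and (a,−k), always common transforms, and is unique up to n→−n among generic mates; the two transforms must not share both distance and angle (else no new d exists); common tangent planes count as tangent spheres. *)

(* Defs.v *)
From mathcomp Require Import all_boot all_order all_algebra.
From mathcomp Require Import reals trigo.

Set Implicit Arguments.
Unset Strict Implicit.
Unset Printing Implicit Defensive.

Import Order.TTheory GRing.Theory Num.Theory.
Local Open Scope ring_scope.

(* Euclidean three-space is 'rV[R]_3 for a realType R. The library's norm on   *)
(* row vectors is the sup norm, hence the Euclidean scalar product and norm    *)
(* below.                                                                      *)
Section EuclideanSpace.
Variable R : realType.
Implicit Types u v w n m o p q x : 'rV[R]_3.

Definition dot u v : R := (u *m v^T) 0 0.
Definition enorm u : R := Num.sqrt (dot u u).

(* Indices are added modulo 3. *)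
Definition cross u v : 'rV[R]_3 :=
  \row_(i < 3) (u 0 (i + 1) * v 0 (i + 2%:R) - u 0 (i + 2%:R) * v 0 (i + 1)).

Definition direction p q : 'rV[R]_3 := (enorm (q - p))^-1 *: (q - p).

Definition on_line o v x : Prop := exists t : R, x = o + t *: v.

(* For unit vectors n, m orthogonal to the unit vector u: turning n through    *)
(* the angle phi, counter-clockwise for an observer looking in the direction   *)
(* of u, gives m. Such an observer sees right-handed rotations about u as      *)
(* clockwise, which is why the quarter turn of n is n x u and not u x n.       *)
Definition oriented_angle u n m (phi : R) : Prop :=
  m = cos phi *: n + sin phi *: cross n u.

(* The twist of the oriented lines through p, q in directions n, m; x and y    *)
(* are the feet of a common perpendicular. Interchanging the lines reverses    *)
(* both the viewing direction and the sense of the angle, so that the twist is *)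
(* symmetric.                                                                  *)
Definition twist p n q m (tau : R) : Prop :=
  exists x y : 'rV[R]_3, exists phi : R,
    [/\ on_line p n x /\ on_line q m y, x <> y,
        dot (y - x) n = 0 /\ dot (y - x) m = 0,
        oriented_angle (direction x y) n m phi
      & tau = sin phi / enorm (y - x)].

Definition skew o v o' v' : Prop :=
  cross v v' <> 0 /\ (forall x, ~ (on_line o v x /\ on_line o' v' x)).

(* Line coordinates (direction, moment); two lines with coordinate vectors L   *)
(* and L' are coplanar (intersecting, possibly at infinity) if and only if     *)
(* L *m klein_form *m L'^T = 0, and a vector L represents a line if and only   *)
(* if it is a zero of the quadratic form L *m klein_form *m L^T.               *)
Definition pluecker o v : 'rV[R]_(3 + 3) := row_mx v (cross o v).
Definition klein_form : 'M[R]_(3 + 3) := block_mx 0 1%:M 1%:M 0.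

(* The row space consists of all L that satisfy the linear transversality      *)
(* conditions for the four lines (o t, v t).                                   *)
Definition transversal_space (o v : 'I_4 -> 'rV[R]_3) : 'M[R]_(3 + 3) :=
  kermx (klein_form *m (\matrix_(t < 4) pluecker (o t) (v t))^T).

(* The transversals are the zeros, in the complex projective space over        *)
(* transversal_space, of the restriction of the Klein form. There are two of   *)
(* them in the algebraic sense (real, conjugate complex, or one of             *)
(* multiplicity two) if and only if this projective space is a line and the    *)
(* restriction is a nonzero binary quadratic form.                             *)
Definition two_transversals (o v : 'I_4 -> 'rV[R]_3) : Prop :=
  \rank (transversal_space o v) = 2%N /\
  exists L : 'rV[R]_(3 + 3),
    (L <= transversal_space o v)%MS /\ L *m klein_form *m L^T <> 0.

Record displacement := Displacement {
  linear_part : 'M[R]_3;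
  translation : 'rV[R]_3;
  linear_part_orthogonal : linear_part *m linear_part^T = 1%:M;
  linear_part_direct : \det linear_part = 1 }.

Definition displace (A : displacement) x := x *m linear_part A + translation A.

Record contact_element := ContactElement {
  point : 'rV[R]_3;
  normal : 'rV[R]_3;
  normal_unit : dot normal normal = 1 }.

Lemma reverse_unit (e : contact_element) : dot (- normal e) (- normal e) = 1.
Proof. by rewrite /dot linearN mulmxN mulNmx opprK; exact: normal_unit. Qed.

Definition reverse (e : contact_element) : contact_element :=
  ContactElement (point e) (reverse_unit e).

Definition on_tangent_plane (e : contact_element) x : Prop :=
  dot (x - point e) (normal e) = 0.

(* As usual in sphere geometry, oriented planes are spheres of infinite        *)
(* radius: the second alternative is the limit in which the normal lines meet  *)
(* at infinity, and is relevant only if the two normals are equal.             *)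
Definition common_tangent_sphere (e f : contact_element) : Prop :=
  (exists r : R, point e + r *: normal e = point f + r *: normal f) \/
  (normal e = normal f /\ on_tangent_plane e (point f)).

(* The three conditions on Baecklund mates at one pair of corresponding        *)
(* contact elements. *)
Definition mate_elements (delta phi : R) (e f : contact_element) : Prop :=
  [/\ enorm (point f - point e) = delta,
      oriented_angle (direction (point e) (point f)) (normal e) (normal f) phi,
      point e <> point f
    & forall x, on_tangent_plane e x /\ on_tangent_plane f x <->
                on_line (point e) (point f - point e) x].

Definition figure_at (A : displacement) (e0 f0 e f : contact_element) : Prop :=
  [/\ displace A (point e0) = point e, normal e0 *m linear_part A = normal e,
      displace A (point f0) = point f & normal f0 *m linear_part A = normal f].

(* The lines (o t, v t) are the relative revolute axes in the moving space;    *)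
(* that the coincidence set of A t and A (t + 1) is a line says that the       *)
(* relative displacement is a proper rotation. Indices are added modulo 4.     *)
Definition generic_positions (e f : 'I_4 -> contact_element) : Prop :=
  exists (e0 f0 : contact_element) (A : 'I_4 -> displacement)
         (o v : 'I_4 -> 'rV[R]_3),
    [/\ forall t, figure_at (A t) e0 f0 (e t) (f t),
        forall t, v t <> 0 /\
          (forall x, displace (A t) x = displace (A (t + 1)) x <->
                     on_line (o t) (v t) x),
        two_transversals o v
      & forall t, skew (o t) (v t) (o (t + 1)) (v (t + 1))].

(* The oriented area of a planar quadrilateral, times the unit normal of its   *)
(* plane. *)
Definition vector_area (x : 'I_4 -> 'rV[R]_3) : 'rV[R]_3 :=
  2^-1 *: cross (x 2%:R - x 0) (x 3%:R - x 1).

Definition gaussian_curvature (e : 'I_4 -> contact_element) (K : R) : Prop :=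
  vector_area (fun t => point (e t)) <> 0 /\
  vector_area (fun t => normal (e t)) =
    K *: vector_area (fun t => point (e t)).

End EuclideanSpace.

Section Nets.
Variables (R : realType) (s : nat).

Definition net := 'rV[int]_s -> contact_element R.
Implicit Types (X Y : net) (i : 'rV[int]_s) (j k : 'I_s).

Definition shift i j : 'rV[int]_s := i + delta_mx 0 j.

(* In cyclic order around the elementary quadrilateral. *)
Definition quad X i j k (t : 'I_4) : contact_element R :=
  X (nth i [:: i; shift i j; shift (shift i j) k; shift i k] t).

Definition principal X : Prop :=
  forall i j, common_tangent_sphere (X i) (X (shift i j)).

Definition mates_with (delta phi : R) X Y : Prop :=
  forall i, mate_elements delta phi (X i) (Y i).

Definition baecklund_mates X Y : Prop :=
  [/\ principal X, principal Y & exists delta phi, mates_with delta phi X Y].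

Definition net_twist X Y (tau : R) : Prop :=
  forall i, twist (point (X i)) (normal (X i)) (point (Y i)) (normal (Y i)) tau.

Definition curvature_defined X : Prop :=
  forall i j k, j != k -> exists K, gaussian_curvature (quad X i j k) K.

Definition generic_mates X Y : Prop :=
  forall i j k, j != k -> generic_positions (quad X i j k) (quad Y i j k).

(* If (q, m) is a Baecklund transform of a net, so is (q, -m), with the angle  *)
(* changed by pi; hence the identification of a net with its reversal.         *)
Definition same_net X Y : Prop :=
  (forall i, Y i = X i) \/ (forall i, Y i = reverse (X i)).

(* Being mates is a symmetric relation, so X itself is a common transform of   *)
(* its transforms Y and Z; W is another one.                                   *)
Definition fourth_net X Y Z W : Prop :=
  [/\ baecklund_mates Y W, baecklund_mates Z W & ~ same_net X W].

End Nets.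

(* Main.v *)
Require Import Defs.
From HB Require Import structures.
From mathcomp Require Import all_boot all_order all_algebra.
From mathcomp Require Import reals trigo ring lra.

(* In terms of the unit normals, (a, k) and (b, l) are mates of twist t if and *)
(* only if t (b - a) = l x k and k . l is constant. Hence a common transform   *)
(* (d, n) of b and c of the same twist satisfies (l - m) x (n - k) = 0, which  *)
(* leaves n = k and the reflection n of k in the plane orthogonal to l - m.    *)
(*                                                                             *)
(* To see that d is principal, write displacements as dual quaternions. Two    *)
(* contact elements have a common tangent sphere if and only if all            *)
(* displacements that take one to the other are rotations. The displacements   *)
(* of the figures (b, d) and (c, d) along an edge are such rotations because b *)
(* and c are principal, and they differ by a rotation about the normal line N  *)
(* of d; therefore the axis of the first one meets N. If they do not differ at *)
(* all, the axis meets the normal lines of a, b, c, and N is linearly          *)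
(* dependent on these three.                                                   *)
(*                                                                             *)
(* For uniqueness, the twist t of any transform must be found. Closing the     *)
(* chain of four relative rotations over a quadrilateral gives a relation      *)
(* between the points in which the axes meet a normal line, and this relation  *)
(* says that the vector areas of normals and points have ratio - t^2. So t is  *)
(* known up to sign. Opposite signs for b and c force a, b, c to be collinear  *)
(* with constant ratio; then all axes meet three independent lines, contrary   *)
(* to the assumption on transversals.                                          *)

Set Implicit Arguments.
Unset Strict Implicit.
Unset Printing Implicit Defensive.

Import Order.TTheory GRing.Theory Num.Theory.
Local Open Scope ring_scope.

(** * Vectors and quaternions *)

(** By [mate_elements_mated] and its converse [mated_mate_elements], mates are described by the
    signed twist t and the cosine of the angle alone, and a point is determined by its mate and the
    two normals. At a single index the problem is then algebra: the ways from a to d through b and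
    through c give one vector equation, whose solution other than k exchanges the two cosines
    ([fourth_unique], [fourth_mated]).

    Three matters involve several indices. Tangency along an edge amounts to two scalar equations
    for a dual quaternion ([carries_tangent]); for d, the first is inherited from b, and the second
    follows from c or, in a degenerate case, from the dependence of the four normal lines
    ([fourth_tangent]). The twist of an unknown common transform is t or -t, because the curvature
    of a net is minus the squared twist of any of its pairs ([mate_area]); reversing the net absorbs
    two equal signs, and [no_opposite_transform] excludes different ones. Finally, constancy of the
    angle selects the same solution at every index ([fourth_net_unique]). *)

Section Vectors.
Variable R : realType.
Implicit Types (u v w : 'rV[R]_3) (a : R).

Lemma vec3P u v :
  u 0 0 = v 0 0 -> u 0 1 = v 0 1 -> u 0 2%:R = v 0 2%:R -> u = v.
Proof.
move=> e0 e1 e2; apply/rowP => -[[|[|[|//]]] h].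
- by rewrite (_ : Ordinal h = 0) //; apply: val_inj.
- by rewrite (_ : Ordinal h = 1) //; apply: val_inj.
- by rewrite (_ : Ordinal h = 2%:R) //; apply: val_inj.
Qed.

Lemma dotE u v :
  dot u v = u 0 0 * v 0 0 + u 0 1 * v 0 1 + u 0 2%:R * v 0 2%:R.
Proof.
rewrite /dot mxE !big_ord_recl big_ord0 !mxE addr0 addrA.
by congr (u 0 _ * v 0 _ + u 0 _ * v 0 _ + u 0 _ * v 0 _); apply: val_inj.
Qed.

Lemma crossE u v :
  ((cross u v) 0 0 = u 0 1 * v 0 2%:R - u 0 2%:R * v 0 1) *
  ((cross u v) 0 1 = u 0 2%:R * v 0 0 - u 0 0 * v 0 2%:R) *
  ((cross u v) 0 2%:R = u 0 0 * v 0 1 - u 0 1 * v 0 0).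
Proof.
rewrite !mxE; do !split;
  congr (u 0 _ * v 0 _ - u 0 _ * v 0 _); exact: val_inj.
Qed.

End Vectors.

Ltac vec_ring :=
  try apply: vec3P; rewrite ?(dotE, crossE, mxE); ring.

Section VectorIdentities.
Variable R : realType.
Implicit Types (u v w z : 'rV[R]_3) (a : R).

Lemma dotC u v : dot u v = dot v u. Proof. vec_ring. Qed.
Lemma dotDl u v w : dot (u + v) w = dot u w + dot v w. Proof. vec_ring. Qed.
Lemma dotDr u v w : dot w (u + v) = dot w u + dot w v. Proof. vec_ring. Qed.
Lemma dotNl u v : dot (- u) v = - dot u v. Proof. vec_ring. Qed.
Lemma dotNr u v : dot u (- v) = - dot u v. Proof. vec_ring. Qed.
Lemma dotZl a u v : dot (a *: u) v = a * dot u v. Proof. vec_ring. Qed.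
Lemma dotZr a u v : dot u (a *: v) = a * dot u v. Proof. vec_ring. Qed.
Lemma dot0l u : dot 0 u = 0. Proof. vec_ring. Qed.
Lemma dot0r u : dot u 0 = 0. Proof. vec_ring. Qed.

Definition dot_linear := (dotDl, dotDr, dotNl, dotNr, dotZl, dotZr).

Lemma crossC u v : cross u v = - cross v u. Proof. vec_ring. Qed.
Lemma crossDl u v w : cross (u + v) w = cross u w + cross v w.
Proof. vec_ring. Qed.
Lemma crossDr u v w : cross w (u + v) = cross w u + cross w v.
Proof. vec_ring. Qed.
Lemma crossNl u v : cross (- u) v = - cross u v. Proof. vec_ring. Qed.
Lemma crossNr u v : cross u (- v) = - cross u v. Proof. vec_ring. Qed.
Lemma crossZl a u v : cross (a *: u) v = a *: cross u v. Proof. vec_ring. Qed.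
Lemma crossZr a u v : cross u (a *: v) = a *: cross u v. Proof. vec_ring. Qed.
Lemma crossvv u : cross u u = 0. Proof. vec_ring. Qed.

Lemma dot_crossl u v : dot u (cross u v) = 0. Proof. vec_ring. Qed.
Lemma dot_crossr u v : dot v (cross u v) = 0. Proof. vec_ring. Qed.
Lemma cross_crossl u v w : cross (cross u v) w = dot u w *: v - dot v w *: u.
Proof. vec_ring. Qed.
Lemma cross_crossr u v w : cross u (cross v w) = dot u w *: v - dot u v *: w.
Proof. vec_ring. Qed.
Lemma dot_cross_cross u v w z :
  dot (cross u v) (cross w z) = dot u w * dot v z - dot u z * dot v w.
Proof. vec_ring. Qed.

Lemma dotvv_ge0 u : 0 <= dot u u.
Proof. by rewrite dotE -!expr2 !addr_ge0 ?sqr_ge0. Qed.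

Lemma dotvv_eq0 u : (dot u u == 0) = (u == 0).
Proof.
apply/eqP/eqP => [|->]; last exact: dot0l.
rewrite dotE -!expr2 => /eqP.
rewrite paddr_eq0 ?addr_ge0 ?sqr_ge0 // paddr_eq0 ?sqr_ge0 // !sqrf_eq0.
by move=> /andP[/andP[/eqP e0 /eqP e1] /eqP e2]; apply: vec3P; rewrite mxE.
Qed.

Lemma dotvv_gt0 u : u != 0 -> 0 < dot u u.
Proof. by rewrite lt_def dotvv_ge0 dotvv_eq0 andbT. Qed.

Lemma enorm_sqr u : enorm u ^+ 2 = dot u u.
Proof. by rewrite sqr_sqrtr ?dotvv_ge0. Qed.

Lemma enorm_ge0 u : 0 <= enorm u. Proof. exact: sqrtr_ge0. Qed.

Lemma enorm_eq0 u : (enorm u == 0) = (u == 0).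
Proof. by rewrite -dotvv_eq0 -enorm_sqr sqrf_eq0. Qed.

End VectorIdentities.

(** The regular module [R^o] lets the product type inherit a componentwise [Lmodule] structure, to
    which Hamilton's product is added. *)
Definition quat (R : realType) : Type := (R^o * 'rV[R]_3)%type.

Section Quaternions.
Variable R : realType.
Notation quat := (quat R).

HB.instance Definition _ := GRing.Lmodule.on quat.
HB.instance Definition _ := Choice.on quat.

Implicit Types (x y z : quat) (u v w n m p q : 'rV[R]_3) (a b : R).

Definition qone : quat := (1, 0).
Definition qmul x y : quat :=
  (x.1 * y.1 - dot x.2 y.2, x.1 *: y.2 + y.1 *: x.2 + cross x.2 y.2).

Lemma quatP x y : x.1 = y.1 -> x.2 = y.2 -> x = y.
Proof. by case: x y => [? ?] [? ?] /= -> ->. Qed.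

Lemma qmulA : associative qmul.
Proof. by move=> x y z; apply: quatP => /=; vec_ring. Qed.
Lemma qmul1l : left_id qone qmul.
Proof. by move=> x; apply: quatP => /=; vec_ring. Qed.
Lemma qmul1r : right_id qone qmul.
Proof. by move=> x; apply: quatP => /=; vec_ring. Qed.
Lemma qmulDl : left_distributive qmul +%R.
Proof. by move=> x y z; apply: quatP => /=; vec_ring. Qed.
Lemma qmulDr : right_distributive qmul +%R.
Proof. by move=> x y z; apply: quatP => /=; vec_ring. Qed.
Lemma qone_neq0 : qone != 0.
Proof. by apply/eqP => -[/eqP]; rewrite oner_eq0. Qed.

HB.instance Definition _ := GRing.Zmodule_isNzRing.Build quat
  qmulA qmul1l qmul1r qmulDl qmulDr qone_neq0.

Lemma qscaleAl a x y : a *: (x * y) = (a *: x) * y.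
Proof. by apply: quatP => /=; rewrite /GRing.scale /=; vec_ring. Qed.
Lemma qscaleAr a x y : a *: (x * y) = x * (a *: y).
Proof. by apply: quatP => /=; rewrite /GRing.scale /=; vec_ring. Qed.

HB.instance Definition _ := GRing.Lmodule_isLalgebra.Build R quat qscaleAl.
HB.instance Definition _ := GRing.Lalgebra_isAlgebra.Build R quat qscaleAr.

Lemma qmulE x y : x * y =
  (x.1 * y.1 - dot x.2 y.2, x.1 *: y.2 + y.1 *: x.2 + cross x.2 y.2).
Proof. by []. Qed.
Lemma qscaleE a x : a *: x = (a * x.1, a *: x.2) :> quat. Proof. by []. Qed.
Lemma qaddE x y : x + y = (x.1 + y.1, x.2 + y.2). Proof. by []. Qed.
Lemma qoppE x : - x = (- x.1, - x.2). Proof. by []. Qed.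
Lemma qoneE : 1 = (1, 0) :> quat. Proof. by []. Qed.
Lemma qzeroE : 0 = (0, 0) :> quat. Proof. by []. Qed.

Definition pure v : quat := (0, v).
Definition conjq x : quat := (x.1, - x.2).
Definition normq x : R := x.1 ^+ 2 + dot x.2 x.2.

End Quaternions.

Ltac quat_ring :=
  apply: quatP; rewrite ?(qmulE, qscaleE, qaddE, qoppE, qoneE, qzeroE) /=; vec_ring.

Section QuaternionIdentities.
Variable R : realType.
Implicit Types (x y z : quat R) (u v w n m p q : 'rV[R]_3) (a b : R).

Lemma pureD u v : pure (u + v) = pure u + pure v. Proof. quat_ring. Qed.
Lemma pureN u : pure (- u) = - pure u. Proof. quat_ring. Qed.
Lemma pureZ a u : pure (a *: u) = a *: pure u. Proof. quat_ring. Qed.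
Lemma pureM u v : pure u * pure v = pure (cross u v) - (dot u v)%:A.
Proof. quat_ring. Qed.
Lemma conjqM x y : conjq (x * y) = conjq y * conjq x.
Proof. quat_ring. Qed.
Lemma mulq_conjl x : conjq x * x = (normq x)%:A.
Proof. rewrite /normq; quat_ring. Qed.
Lemma mulq_conjr x : x * conjq x = (normq x)%:A.
Proof. rewrite /normq; quat_ring. Qed.
Lemma normq_eq0 x : (normq x == 0) = (x == 0).
Proof.
rewrite /normq paddr_eq0 ?sqr_ge0 ?dotvv_ge0 // sqrf_eq0 dotvv_eq0.
by case: x.
Qed.
Lemma mulq_eq0 x y : (x * y == 0) = (x == 0) || (y == 0).
Proof.
apply/idP/idP => [/eqP e|]; last by case/orP => /eqP ->; rewrite ?mulr0 ?mul0r.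
case: eqVneq => //=; rewrite -normq_eq0 => nx.
have: conjq x * (x * y) = 0 by rewrite e mulr0.
rewrite mulrA mulq_conjl -scalerAl mul1r => /eqP.
by rewrite scaler_eq0 (negbTE nx).
Qed.
End QuaternionIdentities.

(** * Tangent spheres and displacements *)

Section Carrying.
Variable R : realType.
Implicit Types (x y z : quat R) (u v w n m p q : 'rV[R]_3) (a b : R).

(* Its scalar and vector parts express orthogonality of p' - p to n + n' and   *)
(* parallelity to n' - n.                                                      *)
Definition tangent_quat p n p' n' : quat R :=
  pure (p' - p) * pure n' + pure n * pure (p' - p).

(** If the normals differ, the vector part makes p' - p a multiple of n' - n, and minus the factor
    is the radius. If they agree, only the scalar part is informative, and it gives the alternative
    of a common plane. *)
Lemma common_tangent_sphereP (e f : contact_element R) :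
  common_tangent_sphere e f <->
  tangent_quat (point e) (normal e) (point f) (normal f) = 0.
Proof.
case: e f => [p n n1] [p' n' n1'] /=; rewrite /common_tangent_sphere /=.
have E w : pure w * pure n' + pure n * pure w =
    (- dot w (n + n'), cross w (n' - n)) by quat_ring.
rewrite /tangent_quat E; split.
  case=> [[r er]|[<- h]].
    have -> : p' - p = r *: (n - n').
      by rewrite scalerBr -(addrK (r *: n') p') -er; vec_ring.
    apply: quatP => /=; last by vec_ring.
    by rewrite !dot_linear (dotC n' n) n1 n1'; ring.
  rewrite subrr; move: h; rewrite /on_tangent_plane /= => h.
  by apply: quatP => /=; [rewrite dotDr h addr0 oppr0 | vec_ring].
move=> -[/eqP]; rewrite oppr_eq0 dotDr => /eqP h0 h.
have [e|ne] := eqVneq n n'.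
  right; split=> //; rewrite /on_tangent_plane /=.
  by move: h0; rewrite -e; lra.
left; set g := n' - n; have g0 : g != 0 by rewrite subr_eq0 eq_sym.
have gg := dotvv_gt0 g0.
have := cross_crossr g (p' - p) g; rewrite h => k.
have {}k : dot g g *: (p' - p) = dot g (p' - p) *: g.
  apply/eqP; rewrite -subr_eq0 -k; apply/eqP; vec_ring.
exists (- (dot g (p' - p) / dot g g)).
have {k} : p' - p = (dot g (p' - p) / dot g g) *: g.
  apply: (scalerI (lt0r_neq0 gg)); rewrite k scalerA; congr (_ *: _).
  by field; rewrite lt0r_neq0.
set r := _ / _ => k; apply/eqP; rewrite -subr_eq0; apply/eqP.
rewrite (_ : _ - _ = r *: g - (p' - p)); first by rewrite k subrr.
rewrite /g; vec_ring.
Qed.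

Lemma conjq_pure v : conjq (pure v) = - pure v.
Proof. by quat_ring. Qed.

Lemma conjq_intertwine x n n' : pure n' * x = x * pure n ->
  conjq x * pure n' = pure n * conjq x.
Proof.
move=> /(congr1 (@conjq R)); rewrite !conjqM !conjq_pure mulrN mulNr.
by move/oppr_inj.
Qed.

Lemma normq_conj x : normq (conjq x) = normq x.
Proof. by rewrite /normq /= dotNl dotNr opprK. Qed.

(* The displacement that takes the contact element (p, n) to (p', n'), encoded *)
(* by the (not necessarily normalized) dual quaternion x + eps y.              *)
Definition carries x y p n p' n' : Prop :=
  pure n' * x = x * pure n /\ pure p' * x = x * pure p + 2 *: y.

(* Vanishes if and only if the line with Pluecker coordinates (x.2, y.2) meets *)
(* the line through p in direction n.                                          *)
Definition incidence x y p n : R := dot y.2 n + dot x.2 (cross p n).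

Lemma carries_conj x y p n p' n' : carries x y p n p' n' ->
  conjq x * pure p' = pure p * conjq x - 2 *: conjq y.
Proof.
case=> _ /(congr1 (@conjq R)); rewrite conjqM conjq_pure mulrN => h.
apply: oppr_inj; rewrite h (_ : conjq (_ + _) =
  conjq (x * pure p) + 2 *: conjq y); last by quat_ring.
by rewrite conjqM conjq_pure mulNr opprB addrC.
Qed.

Definition relx x x' : quat R := conjq x * x'.
Definition rely x y x' y' : quat R := conjq x * y' + conjq y * x'.

(* The dual quaternion product of the conjugate of x + eps y with x' + eps y'  *)
(* describes the relative displacement, seen from the moving space.            *)
Lemma relative_point x y x' y' p n m p1 n1 p2 n2 :
    carries x y p n p1 n1 -> carries x' y' p m p2 n2 ->
  conjq x * pure (p2 - p1) * x' =
    relx x x' * pure p + 2 *: rely x y x' y' - pure p * relx x x'.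
Proof.
move=> h [_ h']; rewrite pureD pureN mulrBr mulrBl (carries_conj h).
rewrite -mulrA h' mulrDr mulrBl -!scalerAr -scalerAl /relx /rely.
by rewrite scalerDr !mulrA opprB !addrA.
Qed.

(** The anticommutator with the normal separates the incidence from the dual scalar part, so that
    one quaternion equation splits into two scalar ones. *)
Lemma anticommutator_incidence x y p n :
  (x * pure p + 2 *: y - pure p * x) * pure n
    + pure n * (x * pure p + 2 *: y - pure p * x) =
  (- 4 * incidence x y p n, (4 * y.1) *: n).
Proof.
have -> : x * pure p + 2 *: y - pure p * x =
    (2 * y.1, 2 *: y.2 + 2 *: cross x.2 p) by quat_ring.
have -> : - 4 * incidence x y p n = - 2 * dot (2 *: y.2 + 2 *: cross x.2 p) n.
  by rewrite /incidence; vec_ring.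
by quat_ring.
Qed.

(* A relative displacement with vanishing dual scalar part is a rotation; all  *)
(* displacements that take one contact element to another are rotations if     *)
(* they have a common tangent sphere.                                          *)
Lemma relative_tangent x y x' y' p n p1 n1 p2 n2 :
    x != 0 -> x' != 0 -> dot n n = 1 ->
    carries x y p n p1 n1 -> carries x' y' p n p2 n2 ->
  (tangent_quat p1 n1 p2 n2 = 0 <->
   (rely x y x' y').1 = 0 /\ incidence (relx x x') (rely x y x' y') p n = 0).
Proof.
move=> x0 x0' nn h h'.
have := anticommutator_incidence (relx x x') (rely x y x' y') p n.
rewrite -(relative_point h h') -mulrA -(proj1 h') mulrA.
rewrite -!(mulrA (conjq x)) !(mulrA (pure n)) -(conjq_intertwine (proj1 h)).
rewrite -!(mulrA (conjq x)) -mulrDr !mulrA -mulrDl => e; split.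
  move=> h0; move: e; rewrite /tangent_quat in h0; rewrite h0 mul0r mulr0.
  move=> -[] /esym h1 /esym h2; split; last by lra.
  move/eqP: h2; rewrite scaler_eq0 mulf_eq0 pnatr_eq0 /= => /orP[/eqP //|].
  by rewrite -dotvv_eq0 nn oner_eq0.
move=> [h1 h2]; move/eqP: e; rewrite h1 h2 !mulr0 scale0r.
rewrite -[X in _ == X]/(0 : quat R) !mulq_eq0 (negbTE x0') orbF.
by rewrite -normq_eq0 normq_conj normq_eq0 (negbTE x0) => /eqP.
Qed.

Lemma carries_tangent x y p n p' n' : x != 0 -> dot n n = 1 ->
    carries x y p n p' n' ->
  (tangent_quat p n p' n' = 0 <-> y.1 = 0 /\ incidence x y p n = 0).
Proof.
move=> x0 nn h.
have h1 : carries 1 0 p n p n.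
  by split; rewrite mul1r mulr1 // scaler0 addr0.
have := relative_tangent (oner_neq0 _) x0 nn h1 h.
have c1 : conjq 1 = 1 :> quat R by quat_ring.
have c0 : conjq 0 = 0 :> quat R by quat_ring.
by rewrite /relx /rely c1 c0 !mul1r mul0r addr0.
Qed.
End Carrying.

(** * Quaternions that rotate one pair of vectors into another *)

Section Rotors.
Variable R : realType.
Implicit Types (x y z : quat R) (u v w n m p q : 'rV[R]_3) (a b c t : R).

Lemma common_tangent_sphere_sym (e f : contact_element R) :
  common_tangent_sphere e f -> common_tangent_sphere f e.
Proof.
case=> [[r h]|[h1 h2]]; first by left; exists r.
right; split=> //; move: h2; rewrite /on_tangent_plane -h1.
by rewrite -opprB dotNl => /eqP; rewrite oppr_eq0 => /eqP.
Qed.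

Lemma mul_pure_self u : pure u * pure u = - (dot u u)%:A.
Proof. by rewrite pureM crossvv (_ : pure 0 = 0) // add0r. Qed.

Lemma pure_anticomm u v : dot u v = 0 -> pure u * pure v = - (pure v * pure u).
Proof. by move=> h; rewrite !pureM (dotC v) h scale0r !subr0 crossC pureN. Qed.

Let E0 : 'rV[R]_3 := delta_mx 0 0.
Let E1 : 'rV[R]_3 := delta_mx 0 1.
Let E2 : 'rV[R]_3 := delta_mx 0 2%:R.

Lemma basisE (i j : 'I_3) :
  (delta_mx 0 i : 'rV[R]_3) 0 j = (val j == val i)%:R.
Proof. by rewrite mxE eqxx. Qed.

(** The left-hand side is the trace of the linear map z |-> x z y on the four-dimensional space of
    quaternions. *)
Lemma mul_trace x y : (x * (1, 0) * y).1 + (x * (0, E0) * y).2 0 0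
  + (x * (0, E1) * y).2 0 1 + (x * (0, E2) * y).2 0 2%:R = 4 * x.1 * y.1.
Proof.
rewrite /E0 /E1 /E2 !qmulE /= !(dotE, crossE, basisE, mxE) /=.
ring.
Qed.

Lemma mul_trace_combination a (x y x' y' x2 y2 x3 y3 : quat R) :
  let f z := a *: (x * z * y) - a *: (x' * z * y') - x2 * z * y2 + x3 * z * y3 in
  (f (1, 0)).1 + (f (0, E0)).2 0 0 + (f (0, E1)).2 0 1 + (f (0, E2)).2 0 2%:R
  = a * (4 * x.1 * y.1) - a * (4 * x'.1 * y'.1) - 4 * x2.1 * y2.1
    + 4 * x3.1 * y3.1.
Proof.
have L1 (p q r s : quat R) :
    (a *: p - a *: q - r + s).1 = a * p.1 - a * q.1 - r.1 + s.1 by [].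
have L2 (p q r s : quat R) i : (a *: p - a *: q - r + s).2 0 i
    = a * p.2 0 i - a * q.2 0 i - r.2 0 i + s.2 0 i by rewrite /= !mxE.
by move=> f; rewrite /f L1 !L2 -!mul_trace; ring.
Qed.

Lemma trace_neq0 (f : quat R -> quat R) :
  (f (1, 0)).1 + (f (0, E0)).2 0 0 + (f (0, E1)).2 0 1 + (f (0, E2)).2 0 2%:R
    != 0 -> exists z, f z != 0.
Proof.
move=> nz.
have [h1|] := eqVneq (f (1, 0)) 0; last by exists (1, 0).
have [h2|] := eqVneq (f (0, E0)) 0; last by exists (0, E0).
have [h3|] := eqVneq (f (0, E1)) 0; last by exists (0, E1).
have [h4|] := eqVneq (f (0, E2)) 0; last by exists (0, E2).
by move: nz; rewrite h1 h2 h3 h4 /= !mxE !addr0 eqxx.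
Qed.

(* Averaging z over the maps z |-> g' z g^-1, for g in the quaternion group    *)
(* generated by n and u, projects onto the solution space. The projection is   *)
(* not zero because its trace is not.                                          *)
Lemma rotor_exists n u n' u' : dot n n = 1 -> dot n' n' = 1 ->
    dot n u = 0 -> dot n' u' = 0 -> dot u u = dot u' u' -> u != 0 ->
  exists x, [/\ x != 0, pure n' * x = x * pure n & pure u' * x = x * pure u].
Proof.
move=> n1 n1' nu nu' uu u0; pose a := dot u u.
have a0 : a != 0 by rewrite /a dotvv_eq0.
have N : pure n * pure n = -1 by rewrite mul_pure_self n1 scale1r.
have N' : pure n' * pure n' = -1 by rewrite mul_pure_self n1' scale1r.
have U : pure u * pure u = - a%:A by rewrite mul_pure_self.
have U' : pure u' * pure u' = - a%:A by rewrite mul_pure_self -uu.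
pose T (z : quat R) : quat R := z - pure n' * z * pure n.
have Tn z : pure n' * T z = T z * pure n.
  rewrite mulrBr mulrBl !mulrA N' -(mulrA _ (pure n)) N.
  by rewrite mulN1r mulrN1 mulNr !opprK addrC.
pose P (z : quat R) : quat R := a *: T z - pure u' * T z * pure u.
have Pn z : pure n' * P z = P z * pure n.
  rewrite mulrBr mulrBl -scalerAr -scalerAl Tn; congr (_ - _).
  rewrite !mulrA (pure_anticomm nu') !mulNr -(mulrA (pure u') (pure n')) Tn.
  by rewrite -!mulrA (pure_anticomm nu) !mulrN opprK.
have Pu z : pure u' * P z = P z * pure u.
  rewrite mulrBr mulrBl -scalerAr -scalerAl !mulrA U' -(mulrA _ (pure u)) U.
  rewrite !(mulrN, mulNr) !opprK mulr_algr mulr_algl -!scalerAl.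
  by rewrite addrC.
have [z Pz] : exists z, P z != 0.
  (* Only the identity term of [P] contributes to the trace: pure quaternions, and products of
     orthogonal ones, have scalar part 0. *)
  have tr : (P (1, 0)).1 + (P (0, E0)).2 0 0 + (P (0, E1)).2 0 1
      + (P (0, E2)).2 0 2%:R = 4 * a.
    have PE y : P y = a *: (1 * y * 1) - a *: (pure n' * y * pure n)
        - pure u' * y * pure u + (pure u' * pure n') * y * (pure n * pure u).
      by rewrite /P /T mulrBr mulrBl scalerBr !mulrA mul1r mulr1 opprB addrA addrAC.
    rewrite !PE; apply: etrans (mul_trace_combination a 1 1 (pure n') (pure n) (pure u') (pure u)
      (pure u' * pure n') (pure n * pure u)) _.
    by rewrite /= nu (dotC u') nu'; ring.
  by apply: trace_neq0; rewrite tr mulf_neq0 ?pnatr_eq0.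
by exists (P z).
Qed.
End Rotors.

(** * Mates in terms of their normals *)

Section Mates.
Variable R : realType.
Implicit Types (x y z : quat R) (a b c d k l m n p q u v w : 'rV[R]_3).
Implicit Types (C t r : R).

Lemma cross_eq0 n u : n != 0 -> cross u n = 0 -> exists s : R, u = s *: n.
Proof.
move=> n0 h; exists (dot n u / dot n n).
have := cross_crossr n u n; rewrite h (_ : cross n 0 = 0); last by vec_ring.
move=> /esym/eqP; rewrite subr_eq0 => /eqP h'.
apply: (scalerI (a := dot n n)); first by rewrite dotvv_eq0.
by rewrite h' scalerA mulrC divfK ?dotvv_eq0.
Qed.

(* For unit vectors and t != 0, this says that (p, n) and (q, m) are mates of  *)
(* twist t with angle of cosine C.                                             *)
Definition mated t C p n q m : Prop :=
  dot n m = C /\ t *: (q - p) = cross m n.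

Lemma mated_sym t C p n q m : mated t C p n q m -> mated t C q m p n.
Proof.
case=> h1 h2; split; first by rewrite dotC.
by rewrite -opprB scalerN h2 [cross n m]crossC.
Qed.

Lemma mated_perp t C p n q m : t != 0 -> mated t C p n q m ->
  dot (q - p) n = 0 /\ dot (q - p) m = 0.
Proof.
move=> t0 [_ h]; split; apply: (mulfI t0);
  by rewrite -dotZl h dotC ?dot_crossr ?dot_crossl mulr0.
Qed.

Lemma mated_norm t C p n q m : dot n n = 1 -> dot m m = 1 ->
  mated t C p n q m -> t ^+ 2 * dot (q - p) (q - p) = 1 - C ^+ 2.
Proof.
move=> n1 m1 [h1 h2].
have : dot (t *: (q - p)) (t *: (q - p)) = 1 - C ^+ 2.
  by rewrite h2 dot_cross_cross n1 m1 (dotC m) h1; ring.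
by rewrite dotZl dotZr => <-; ring.
Qed.

(** [rotor_exists] applies to n and m x n, which are orthogonal; the length of m x n depends only on
    C and is not 0. The vector m is recovered from these two as C n + n x (m x n). *)
Lemma rotor_pairs_exists C n m n' m' :
    dot n n = 1 -> dot m m = 1 -> dot n' n' = 1 -> dot m' m' = 1 ->
    dot n m = C -> dot n' m' = C -> C ^+ 2 != 1 ->
  exists x, [/\ x != 0, pure n' * x = x * pure n & pure m' * x = x * pure m].
Proof.
move=> n1 m1 n1' m1' nm nm' C1.
have norm v w : dot v v = 1 -> dot w w = 1 -> dot v w = C ->
    dot (cross w v) (cross w v) = 1 - C ^+ 2.
  by move=> v1 w1 vw; rewrite dot_cross_cross v1 w1 (dotC w) vw; ring.
have E v w : dot v v = 1 -> dot v w = C ->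
    pure w = C *: pure v + pure v * pure (cross w v).
  move=> v1 vw; rewrite pureM dot_crossr scale0r subr0 cross_crossr v1 vw.
  by rewrite scale1r pureD pureN pureZ addrC subrK.
have [||||||x [x0 hn hu]] := @rotor_exists R n (cross m n) n' (cross m' n').
- by [].
- by [].
- exact: dot_crossr.
- exact: dot_crossr.
- by rewrite !norm.
- by rewrite -dotvv_eq0 norm // subr_eq0 eq_sym.
exists x; split=> //.
rewrite (E n') // (E n m) // mulrDl mulrDr -scalerAl hn scalerAr.
by rewrite -mulrA hu mulrA hn mulrA.
Qed.

(** The point q is p plus a multiple of m x n, and rotations respect cross products; so a
    displacement that moves p, n and m correctly moves q correctly. *)
Lemma carries_mated t C x y p n q m p' n' q' m' : t != 0 ->
    mated t C p n q m -> mated t C p' n' q' m' ->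
    carries x y p n p' n' -> pure m' * x = x * pure m ->
  carries x y q m q' m'.
Proof.
move=> t0 [c1 h1] [c2 h2] [hn hp] hm; split=> //.
have E : t *: (pure (q' - p') * x) = t *: (x * pure (q - p)).
  have F v w : dot v w = C -> pure (cross w v) = pure w * pure v + C%:A.
    by move=> e; rewrite pureM (dotC w) e subrK.
  rewrite scalerAl scalerAr -!pureZ h1 h2 (F n') // (F n) // mulrDl mulrDr.
  by rewrite -mulrA hn mulrA hm mulrA mulr_algl mulr_algr.
move/(scalerI t0): E; rewrite !pureD !pureN mulrBl mulrBr hp => /eqP.
by rewrite subr_eq => /eqP ->; rewrite addrA subrK.
Qed.

Lemma carries_exists x p n p' n' : pure n' * x = x * pure n ->
  carries x (2^-1 *: (pure p' * x - x * pure p)) p n p' n'.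
Proof.
move=> h; split=> //.
by rewrite scalerA divff ?pnatr_eq0 // scale1r addrC subrK.
Qed.

(** Together with the formula for n, this makes the Pluecker vector of the fourth normal line a
    linear combination of the other three; a line that meets those three meets the fourth. *)
Lemma pluecker_fourth t C1 C2 r a k b l c m d n :
    t != 0 -> dot l l = 1 -> dot m m = 1 ->
    mated t C1 a k b l -> mated t C2 a k c m ->
    mated t C2 b l d n -> mated t C1 c m d n -> n = k + r *: (l - m) ->
  cross d n = cross a k + r *: (cross b l - cross c m).
Proof.
move=> t0 l1 m1 [kl ab] [km ac] [ln bd] [mn cd] en.
apply/eqP; rewrite -subr_eq0; apply/eqP.
have -> : cross d n - (cross a k + r *: (cross b l - cross c m)) =
    cross (d - b + (b - a)) k + r *: (cross (d - b) l - cross (d - c) m).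
  by rewrite en; vec_ring.
apply: (scalerI t0); rewrite scaler0.
have -> : t *: (cross (d - b + (b - a)) k
      + r *: (cross (d - b) l - cross (d - c) m)) =
    cross (t *: (d - b) + t *: (b - a)) k
      + r *: (cross (t *: (d - b)) l - cross (t *: (d - c)) m) by vec_ring.
rewrite bd ab cd.
have -> : cross n l + cross l k = r *: cross l m.
  by rewrite en; vec_ring.
rewrite crossZl !cross_crossl (dotC l k) kl (dotC m k) km l1 m1.
rewrite (dotC n l) ln (dotC n m) mn.
vec_ring.
Qed.

End Mates.

(** * Tangency of the fourth contact elements along an edge *)

Section Edges.
Variable R : realType.
Implicit Types (x y z : quat R) (a b c d k l m n p q u v w : 'rV[R]_3).
Implicit Types (C t r : R).

Lemma mulq_conj_fst x z : (x * z * conjq x).1 = normq x * z.1.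
Proof. by rewrite /normq !qmulE /=; vec_ring. Qed.

Lemma intertwine_dot x n m n' m' : x != 0 ->
    pure n' * x = x * pure n -> pure m' * x = x * pure m ->
  dot n m = dot n' m'.
Proof.
move=> x0 hn hm.
have : pure n' * pure m' * (x * conjq x) = x * (pure n * pure m) * conjq x.
  by rewrite (mulrA x) -hn -(mulrA _ x (pure m)) -hm !mulrA.
rewrite mulq_conjr mulr_algr => /(congr1 fst).
rewrite mulq_conj_fst; rewrite -normq_eq0 in x0.
rewrite qscaleE /= !mul0r !sub0r => /(mulfI x0)/oppr_inj.
by move=> ->.
Qed.

Lemma commutant_pure z n : dot n n = 1 -> z * pure n = pure n * z ->
  z = z.1%:A + dot z.2 n *: pure n.
Proof.
move=> n1 h.
have h0 : cross z.2 n = 0.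
  move: (congr1 snd h) => /=; rewrite !scale0r !addr0 !add0r => /rowP e.
  apply/rowP => i; have := e i; rewrite (crossC n) !mxE; lra.
have := cross_crossr n z.2 n; rewrite h0 n1 scale1r.
rewrite (_ : cross n 0 = 0); last by vec_ring.
move=> /esym /eqP; rewrite subr_eq0 (dotC n) => /eqP e.
by apply: quatP; rewrite qaddE !qscaleE /= ?mulr1 ?mulr0 ?scaler0 ?addr0 ?add0r.
Qed.

(* Two displacements that agree on a contact element differ by a rotation      *)
(* about its normal line.                                                      *)
Lemma carries_compare x y x' y' p n p' n' : dot n n = 1 ->
    carries x y p n p' n' -> carries x' y' p n p' n' ->
  exists g h : R, normq x *: x' = x * (g%:A + h *: pure n) /\
    normq x * y'.1 = g * y.1 - h * incidence x y p n.
Proof.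
move=> n1 [hn hp] [hn' hp'].
pose z := conjq x * x'.
have zn : z * pure n = pure n * z.
  by rewrite -mulrA -hn' mulrA (conjq_intertwine hn) mulrA.
have xz : normq x *: x' = x * z by rewrite mulrA mulq_conjr mulr_algl.
clearbody z; have := commutant_pure n1 zn.
move: z.1 (dot z.2 n) => g h ez; exists g, h; rewrite -ez; split=> //.
have E : (2 * normq x) *: y' = 2 *: (y * z) + x * (pure p * z - z * pure p).
  have -> : (2 * normq x) *: y' = normq x *: (pure p' * x' - x' * pure p).
    by rewrite hp' (addrC _ (2 *: y')) addrK scalerA mulrC.
  rewrite scalerBr scalerAr scalerAl xz mulrA hp mulrDl mulrBr !mulrA.
  by rewrite -scalerAl [X in X - _]addrC -addrA.
have e2 : pure p * z - z * pure p = (2 * h) *: pure (cross p n).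
  rewrite ez mulrDr mulrDl mulr_algl mulr_algr opprD addrACA subrr add0r.
  rewrite -scalerAr -scalerAl -scalerBr !pureM (dotC n) (crossC n) pureN.
  by rewrite opprD !opprK addrACA addNr addr0 -mulr2n -scaler_nat scalerA mulrC. 
have s2 : (y * z).1 = g * y.1 - h * dot y.2 n.
  by rewrite ez mulrDr mulr_algr -scalerAr qaddE !qscaleE qmulE /=; ring.
move: E; rewrite e2 => /(congr1 fst).
have fD (u v : quat R) : (u + v).1 = u.1 + v.1 by [].
have fZ s (u : quat R) : (s *: u).1 = s * u.1 by [].
rewrite -scalerAr fZ fD !fZ s2 /= /incidence; lra.
Qed.

Lemma fourth_tangent t C1 C2 r a k b l c m d n a' k' b' l' c' m' d' n' :
  t != 0 -> C1 ^+ 2 != 1 -> C2 ^+ 2 != 1 ->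
  dot k k = 1 -> dot l l = 1 -> dot m m = 1 -> dot n n = 1 ->
  dot k' k' = 1 -> dot l' l' = 1 -> dot m' m' = 1 -> dot n' n' = 1 ->
  mated t C1 a k b l -> mated t C2 a k c m ->
  mated t C2 b l d n -> mated t C1 c m d n ->
  mated t C1 a' k' b' l' -> mated t C2 a' k' c' m' ->
  mated t C2 b' l' d' n' -> mated t C1 c' m' d' n' ->
  (1 - dot l m) *: (n - k) = r *: (l - m) -> 
  (1 - dot l' m') *: (n' - k') = r *: (l' - m') ->
  dot l m != 1 -> dot l' m' != 1 ->
  tangent_quat a k a' k' = 0 -> tangent_quat b l b' l' = 0 ->
  tangent_quat c m c' m' = 0 ->
  tangent_quat d n d' n' = 0.
Proof.
move=> t0 C1n C2n k1 l1 m1 n1 k1' l1' m1' n1' ab ac bd cd ab' ac' bd' cd'.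
move=> en en' lm lm' Ta Tb Tc.
have [x [x0 xl xn]] :=
  rotor_pairs_exists l1 n1 l1' n1' (proj1 bd) (proj1 bd') C2n.
have [x' [x0' xm' xn']] :=
  rotor_pairs_exists m1 n1 m1' n1' (proj1 cd) (proj1 cd') C1n.
have Xd := carries_exists d d' xn; set y := (X in carries x X) in Xd.
have Xd' := carries_exists d d' xn'; set y' := (X in carries x' X) in Xd'.
have Xb := carries_mated t0 (mated_sym bd) (mated_sym bd') Xd xl.
have Xc' := carries_mated t0 (mated_sym cd) (mated_sym cd') Xd' xm'.
have [y0 Wl] := (carries_tangent x0 l1 Xb).1 Tb.
have [y0' _] := (carries_tangent x0' m1 Xc').1 Tc.
have [g [h [e1 e2]]] := carries_compare n1 Xd Xd'.
apply/(carries_tangent x0 n1 Xd); split=> //.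
(* Both dual scalar parts vanish, so [carries_compare] says that [h] times the incidence with the
   fourth normal line is 0. What remains is h = 0, where one displacement moves all four contact
   elements. *)
move: e2; rewrite y0 y0' !mulr0 add0r => /esym/eqP.
rewrite oppr_eq0 mulf_eq0 => /orP[/eqP h0|/eqP //].
have xx' : normq x *: x' = g *: x.
  by rewrite e1 h0 scale0r addr0 mulr_algr.
have xm : pure m' * x = x * pure m.
  have g0 : g != 0.
    apply/eqP => g0; move/eqP: xx'; rewrite g0 scale0r scaler_eq0 normq_eq0.
    by rewrite (negbTE x0) (negbTE x0').
  apply: (scalerI g0); rewrite scalerAr -xx' -scalerAr xm' scalerAl xx'.
  by rewrite -scalerAl.
have nk v w : dot v w != 1 -> 1 - dot v w != 0.
  by rewrite subr_eq0 eq_sym.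
have lm_lm' := intertwine_dot x0 xl xm.
set e := 1 - dot l m; have e0 : e != 0 by exact: nk.
have solve u v w p : e *: (u - v) = r *: (w - p) -> u = v + (r / e) *: (w - p).
  move=> h'; apply: (scalerI e0); rewrite scalerDr scalerA mulrC divfK //.
  by rewrite -h' scalerBr addrC subrK.
have kn := solve _ _ _ _ en.
(* The coefficient is the same at both ends because the rotation takes l and m to l' and m'. *)
have kn' : n' = k' + (r / e) *: (l' - m').
  by apply: solve; rewrite /e lm_lm'.
have xk : pure k' * x = x * pure k.
  have E u v w p : u = v + (r / e) *: (w - p) -> v = u - (r / e) *: (w - p).
    by move=> ->; rewrite addrK.
  rewrite (E _ _ _ _ kn) (E _ _ _ _ kn') !(pureD, pureN, pureZ).
  rewrite mulrBl mulrBr xn -scalerAl -scalerAr mulrBl mulrBr xl xm.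
  by [].
have Xc := carries_mated t0 (mated_sym cd) (mated_sym cd') Xd xm.
have Xa := carries_mated t0 (mated_sym ab) (mated_sym ab') Xb xk.
have [_ Wm] := (carries_tangent x0 m1 Xc).1 Tc.
have [_ Wk] := (carries_tangent x0 k1 Xa).1 Ta.
rewrite /incidence (pluecker_fourth t0 l1 m1 ab ac bd cd kn).
move: Wk Wl Wm; rewrite /incidence kn !dot_linear => h1 h2 h3.
rewrite [RHS](_ : 0 = (0 + (r / e) * (0 - 0))); last by ring.
by rewrite -{1}h1 -{1}h2 -{1}h3; ring.
Qed.
End Edges.

(** * Curvature *)

Section Displacements.
Variable R : realType.
Implicit Types (x y z : quat R) (u v w n m p q o : 'rV[R]_3) (A : displacement R).

Lemma linear_part_dot A u v :
  dot (u *m linear_part A) (v *m linear_part A) = dot u v.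
Proof.
by rewrite /dot trmx_mul mulmxA -(mulmxA u) linear_part_orthogonal mulmx1.
Qed.

Lemma det_rows (M : 'M[R]_3) :
  \det M = dot (row 2%:R M) (cross (row 0 M) (row 1 M)).
Proof.
rewrite (expand_det_row _ 0) !big_ord_recl big_ord0 /cofactor.
rewrite !(expand_det_row _ (0 : 'I_2)) !big_ord_recl !big_ord0 /cofactor.
rewrite !det_mx11 !(dotE, crossE, mxE) /=.
pose F (i j : nat) : R := M (inord i) (inord j).
have ME i j : M i j = F i j by rewrite /F !inord_val.
by rewrite !ME /=; ring.
Qed.

(** The squared length of the difference of the two sides is 1 - 2 det + 1 = 0. *)
Lemma linear_part_cross A :
  row 2%:R (linear_part A) = cross (row 0 (linear_part A)) (row 1 (linear_part A)).
Proof.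
have E i j : dot (row i (linear_part A)) (row j (linear_part A)) = (i == j)%:R.
  by rewrite !rowE linear_part_dot dotE !mxE /=; case: i j => [[|[|[|//]]] ?] [[|[|[|//]]] ?] /=; ring.
have D := linear_part_direct A; rewrite det_rows in D.
move: D (E 0 0) (E 1 1) (E 2%:R 2%:R) (E 0 1).
move: (row 0 _) (row 1 _) (row 2%:R _) => u v w /= D uu vv ww uv.
apply/eqP; rewrite -subr_eq0 -dotvv_eq0 !dot_linear ww D (dotC _ w) D.
by rewrite dot_cross_cross uu vv uv; apply/eqP; ring.
Qed.

(** A rotor for the first two basis vectors also fits the third, which is their cross product, and
    hence all vectors. *)
Lemma displacement_rotor A : exists x y, x != 0 /\
  forall p n, carries x y p n (displace A p) (n *m linear_part A).
Proof.
pose e i : 'rV[R]_3 := delta_mx 0 i.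
have Ee i : e i *m linear_part A = row i (linear_part A) by rewrite rowE.
have [||||||x [x0 h0 h1]] := @rotor_exists R (e 0) (e 1)
    (e 0 *m linear_part A) (e 1 *m linear_part A); rewrite ?linear_part_dot;
  try by rewrite dotE !mxE /=; ring.
  by rewrite -dotvv_eq0 dotE !mxE /= !mulr0 mulr1 !add0r addr0 oner_eq0.
have ecross : e 2%:R = cross (e 0) (e 1).
  by apply: vec3P; rewrite !crossE !mxE /=; ring.
have d01 : dot (e 0) (e 1) = 0 by rewrite dotE !mxE /=; ring.
have pc u v : dot u v = 0 -> pure (cross u v) = pure u * pure v.
  by move=> h; rewrite pureM h scale0r subr0.
have h2 : pure (e 2%:R *m linear_part A) * x = x * pure (e 2%:R).
  rewrite Ee linear_part_cross -!Ee ecross !pc ?linear_part_dot //.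
  by rewrite -mulrA h1 mulrA h0 mulrA.
have H n : pure (n *m linear_part A) * x = x * pure n.
  have -> : n = n 0 0 *: e 0 + n 0 1 *: e 1 + n 0 2%:R *: e 2%:R.
    by apply: vec3P; rewrite !mxE /=; ring.
  rewrite !mulmxDl -!scalemxAl !pureD !pureZ !mulrDl !mulrDr.
  by rewrite -!scalerAl -!scalerAr h0 h1 h2.
exists x, (2^-1 *: (pure (translation A) * x)); split=> // p n; split=> //.
by rewrite scalerA divff ?pnatr_eq0 // scale1r /displace pureD mulrDl H.
Qed.
Lemma commutator_pure x y p :
  x * pure p + 2 *: y - pure p * x = (2 * y.1, 2 *: (y.2 + cross x.2 p)).
Proof. by quat_ring. Qed.

Lemma nonparallel_exists v : v != 0 -> exists w, cross v w != 0.
Proof.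
move=> v0.
have [h0|] := eqVneq (cross v (delta_mx 0 0)) 0; last by exists (delta_mx 0 0).
have [h1|] := eqVneq (cross v (delta_mx 0 1)) 0; last by exists (delta_mx 0 1).
case/eqP: v0; move/rowP: h0 => h0; move/rowP: h1 => h1.
move: (h0 1) (h0 2%:R) (h1 2%:R); rewrite !crossE !mxE /= => e1 e2 e3.
by apply: vec3P; rewrite mxE; lra.
Qed.

(** The vector parts are, up to the factor [r], the Pluecker coordinates of the axis. With r = 0 the
    relative displacement would be a translation that fixes o, hence the identity, and the
    coincidence set would not be a line. *)
Lemma relative_axis A B x y x' y' o v : x != 0 -> x' != 0 ->
    (forall p n, carries x y p n (displace A p) (n *m linear_part A)) ->
    (forall p n, carries x' y' p n (displace B p) (n *m linear_part B)) ->
    v != 0 ->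
    (forall p, displace A p = displace B p <-> on_line o v p) ->
  exists2 r : R, r != 0 & (relx x x').2 = r *: v /\
    (rely x y x' y').2 = cross o (relx x x').2.
Proof.
move=> x0 x0' hA hB v0 hl.
set X := relx x x'; set Y := rely x y x' y'.
have E p : conjq x * pure (displace B p - displace A p) * x' =
    (2 * Y.1, 2 *: (Y.2 + cross X.2 p)).
  by rewrite (relative_point (hA p 0) (hB p 0)) commutator_pure.
have F p : on_line o v p -> Y.2 + cross X.2 p = 0.
  move/hl => e; move: (E p); rewrite e subrr (_ : pure 0 = 0) // mulr0 mul0r.
  by move=> -[] _ /esym/eqP; rewrite scaler_eq0 pnatr_eq0 => /eqP.
have Fo : Y.2 + cross X.2 o = 0.
  by apply: F; exists 0; rewrite scale0r addr0.
have Yo : Y.2 = cross o X.2.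
  by apply/eqP; rewrite -subr_eq0 -Fo [cross o _]crossC opprK.
have Xv : cross X.2 v = 0.
  have : Y.2 + cross X.2 (o + v) = 0 by apply: F; exists 1; rewrite scale1r.
  by rewrite crossDr addrA Fo add0r.
have [r er] := cross_eq0 v0 Xv.
exists r => //; apply/eqP => r0; rewrite r0 scale0r in er.
have [w vw] := nonparallel_exists v0.
have Y1 : Y.1 = 0.
  have : on_line o v o by exists 0; rewrite scale0r addr0.
  move/hl => e; move: (E o); rewrite e subrr (_ : pure 0 = 0) // mulr0 mul0r.
  by move=> -[] /esym/eqP; rewrite mulf_eq0 pnatr_eq0 => /eqP.
have : displace A (o + w) = displace B (o + w).
  move: (E (o + w)); rewrite Y1 Yo er mulr0.
  rewrite (_ : cross o 0 + _ = 0); last by vec_ring.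
  rewrite scaler0 -[(0, 0)]/(0 : quat R) => /eqP.
  rewrite !mulq_eq0 -normq_eq0 normq_conj normq_eq0 (negbTE x0) (negbTE x0') orbF.
  by move=> /eqP[/eqP]; rewrite subr_eq0 eq_sym => /eqP.
move/hl => [s] /addrI es; move: vw; rewrite es crossZr crossvv scaler0 eqxx //.
Qed.

(** The bilinear form of [klein_form] on pairs (direction, moment). *)
Definition pairing (r s r' s' : 'rV[R]_3) : R := dot r s' + dot s r'.

Lemma skew_pairing o v o' v' : Defs.skew o v o' v' ->
  pairing v (cross o v) v' (cross o' v') != 0.
Proof.
move=> [/eqP vv h]; apply/eqP => e.
have z : dot (o' - o) (cross v v') = 0.
  by apply: oppr_inj; rewrite oppr0 -e /pairing; vec_ring.
set c := cross v v' in vv z; have c2 := vv; rewrite -dotvv_eq0 in c2.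
(* Cramer's rule for the common point o + s v = o' + s' v' of two coplanar lines that are not
   parallel. *)
pose s := dot (cross (o' - o) v') c / dot c c.
pose s' := dot (cross (o' - o) v) c / dot c c.
apply: (h (o + s *: v)); split; first by exists s.
exists s'; apply/eqP; rewrite -subr_eq0; apply/eqP/(scalerI c2).
have -> : dot c c *: (o + s *: v - (o' + s' *: v')) =
    (dot c c * s) *: v - (dot c c * s') *: v' - dot c c *: (o' - o).
  by rewrite !(scalerDr, scalerN, scalerBr, scalerA, opprD); vec_ring.
rewrite /s /s' ![dot c c * (_ / _)]mulrC !divfK // scaler0.
have -> : dot (cross (o' - o) v') c *: v - dot (cross (o' - o) v) c *: v'
   - dot c c *: (o' - o) = - dot (o' - o) c *: c by rewrite /c; vec_ring.
by rewrite z oppr0 scale0r.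
Qed.
End Displacements.

(** * Relative axes and the points in which they meet the normal lines *)

Section Heights.
Variable R : realType.
Implicit Types (x y z : quat R) (u v w k l n m p q o r s : 'rV[R]_3).
Implicit Types (a b c t C : R).

Lemma rank_one a b c (d : R) : a * d = b * c ->
  exists e f g h : R, [/\ a = e * g, b = e * h, c = f * g & d = f * h].
Proof.
move=> e; have [a0|a0] := eqVneq a 0; last first.
  by exists 1, (c / a), a, b; split; rewrite ?mul1r ?divfK // mulrAC (mulrC c) -e mulrAC divff // mul1r.
have [b0|b0] := eqVneq b 0.
  by exists 0, 1, c, d; split; rewrite ?mul1r ?mul0r.
exists 1, (d / b), a, b; split; rewrite ?mul1r ?divfK //.
by apply: (mulfI b0); rewrite -e a0 !(mul0r, mulr0).
Qed.

(* Dual vector part of the product of two rotations about the lines (r, s) and *)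
(* (r', s'), paired with the line through p in direction n.                    *)
Definition product_incidence p n r s r' s' : R :=
  dot (cross r s' + cross s r') n + dot (cross r r') (cross p n).

Lemma cramer3 u v w p : dot u (cross v w) *: p =
  dot p (cross v w) *: u + dot u (cross p w) *: v + dot u (cross v p) *: w.
Proof. by vec_ring. Qed.

(* A line that meets the two normals joins the points p + (h / f) k and        *)
(* q + (g / e) l; the quotients may be infinite.                               *)
Lemma axis_heights t C p k q l r s : t != 0 -> C ^+ 2 != 1 ->
    dot k k = 1 -> dot l l = 1 -> mated t C p k q l ->
    dot s k + dot r (cross p k) = 0 -> dot s l + dot r (cross q l) = 0 ->
    dot r s = 0 ->
  exists e f g h : R, [/\
    r = f *: (e *: (q - p) + g *: l) - (h * e) *: k,
    s + cross r p = h *: cross k (e *: (q - p) + g *: l) &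
    e *: (s + cross r q) + g *: cross r l = 0].
Proof.
move=> t0 C1 k1 l1 hm sk sl rs.
have [kl tw] := hm.
set w := q - p in tw *; set S := s + cross r p.
set K := dot k (cross w l).
(* Since t K = 1 - C^2, the vectors k, w and l form a basis. *)
have K0 : K != 0.
  have : t * K = 1 - C ^+ 2.
    rewrite /K -dotZr -crossZl tw cross_crossl l1 kl.
    by rewrite !dot_linear k1 kl; ring.
  by move=> e; apply/eqP => K0; move: e; rewrite K0 mulr0 => /esym/eqP;
     rewrite subr_eq0 eq_sym (negbTE C1).
have Sk : dot S k = 0 by rewrite -sk /S; vec_ring.
have Sl : dot S l + dot (cross r w) l = 0 by rewrite -sl /S /w; vec_ring.
have rS : dot r S = 0 by rewrite -rs /S; vec_ring.
have Sq : s + cross r q = S + cross r w by rewrite /S /w; vec_ring.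
clearbody S w.
pose a := dot k (cross r l) / K; pose b := dot k (cross w r) / K.
pose d := dot r (cross w l) / K.
have er : r = d *: k + a *: w + b *: l.
  apply: (scalerI K0); rewrite (cramer3 k w l r) -/K !scalerDr !scalerA /a /b /d.
  by rewrite ![K * (_ / K)]mulrC !divfK.
pose a' := dot k (cross (cross S k) l) / K.
pose b' := dot k (cross w (cross S k)) / K.
have eS : S = cross k (a' *: w + b' *: l).
  have e1 : S = cross k (cross S k).
    by rewrite cross_crossr k1 (dotC k) Sk scale1r scale0r subr0.
  rewrite {1}e1; apply: (scalerI K0); rewrite -[LHS]crossZr -[RHS]crossZr (cramer3 k w l (cross S k)).
  rewrite -/K !(crossDr, crossZr) crossvv scaler0 add0r scalerDr !scalerA /a' /b'.
  by rewrite ![K * (_ / K)]mulrC !divfK.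
have a'd : d = - a'.
  apply: (mulIf K0); apply/eqP; rewrite -subr_eq0 -Sl; apply/eqP.
  by rewrite eS er /K; vec_ring.
(* Orthogonality of r and s becomes a vanishing determinant, whose rank one factorization supplies
   the homogeneous heights. *)
have det0 : a * b' = b * a'.
  apply: (mulIf K0); apply/eqP; rewrite -subr_eq0 -oppr_eq0 -rS; apply/eqP.
  by rewrite eS er a'd /K; vec_ring.
have [f [h [e [g [ea eb ea' eb']]]]] := rank_one det0.
exists e, f, g, h.
have er' : r = f *: (e *: w + g *: l) - (h * e) *: k.
  by rewrite er a'd ea eb ea' scalerDr !scalerA scaleNr -addrA addrC.
have eS' : S = h *: cross k (e *: w + g *: l).
  by rewrite eS ea' eb' -crossZr scalerDr !scalerA.
split=> //.
by rewrite Sq eS' {1 2}er'; vec_ring.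
Qed.

(** Both quantities contain the factor f h' - f' h, the only trace of the heights on the first
    normal line; their quotient involves the heights on the second one only. *)
Lemma pairing_heights t C p k q l r s r' s' e f g h e' f' g' h' :
    t != 0 -> C ^+ 2 != 1 -> dot k k = 1 -> dot l l = 1 -> mated t C p k q l ->
    r = f *: (e *: (q - p) + g *: l) - (h * e) *: k ->
    s + cross r p = h *: cross k (e *: (q - p) + g *: l) ->
    r' = f' *: (e' *: (q - p) + g' *: l) - (h' * e') *: k ->
    s' + cross r' p = h' *: cross k (e' *: (q - p) + g' *: l) ->
  t * pairing r s r' s' = (1 - C ^+ 2) * ((f * h' - f' * h) * (g * e' - e * g'))
  /\ t ^+ 2 * product_incidence p k r s r' s'
    = (1 - C ^+ 2) * ((f * h' - f' * h) * (e * e' + t ^+ 2 * (g * g'))).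
Proof.
move=> t0 C1 k1 l1 hm er es er' es'.
have [kl tw] := hm; have [wk wl] := mated_perp t0 hm.
have ww := mated_norm k1 l1 hm.
set w := q - p in er es er' es' tw wk wl ww.
clearbody w.
have tK : t * dot k (cross w l) = 1 - C ^+ 2.
  rewrite -dotZr -crossZl tw cross_crossl l1 kl.
  by rewrite !dot_linear k1 kl; ring.
split.
  have -> : pairing r s r' s' = dot r (s' + cross r' p) + dot (s + cross r p) r'.
    by rewrite /pairing; vec_ring.
  rewrite es es' -tK -mulrA; congr (_ * _).
  by rewrite er er'; vec_ring.
have -> : product_incidence p k r s r' s' =
    dot (cross r (s' + cross r' p) + cross (s + cross r p) r') k.
  by rewrite /product_incidence; vec_ring.
rewrite es es'.
have -> : dot (cross r (h' *: cross k (e' *: w + g' *: l))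
   + cross (h *: cross k (e *: w + g *: l)) r') k =
  (f * h' - f' * h) * (dot k k * (dot (e *: w + g *: l) (e' *: w + g' *: l))
    - dot k (e *: w + g *: l) * dot k (e' *: w + g' *: l)).
  by rewrite er er'; move: (e *: w + _) (e' *: w + _) => u u'; vec_ring.
rewrite !dot_linear k1 l1 kl (dotC k) wk wl (dotC l) wl.
rewrite !(mulr0, mul0r, mulr1, mul1r, add0r, addr0).
ring: ww.
Qed.

(** The Study condition: the norm of the dual quaternion has no dual part. *)
Lemma carries_study x y p n p' n' : carries x y p n p' n' ->
  x * conjq y + y * conjq x = 0.
Proof.
move=> h; have [_ hp] := h; have hc := carries_conj h.
apply: (scalerI (a := 2)); first by rewrite pnatr_eq0.
have e1 : 2 *: y = pure p' * x - x * pure p by rewrite hp addrC addKr.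
have e2 : 2 *: conjq y = pure p * conjq x - conjq x * pure p'.
  by rewrite hc opprB addrCA subrr addr0.
rewrite scaler0 scalerDr scalerAr scalerAl e1 e2 mulrBr mulrBl !mulrA.
rewrite mulq_conjr mulr_algl -(mulrA (pure p')) mulq_conjr mulr_algr.
by rewrite addrA subrK subrr.
Qed.

Lemma relative_mul x0 y0 x1 y1 x2 y2 : x1 * conjq y1 + y1 * conjq x1 = 0 ->
  relx x0 x1 * relx x1 x2 = normq x1 *: relx x0 x2 /\
  relx x0 x1 * rely x1 y1 x2 y2 + rely x0 y0 x1 y1 * relx x1 x2
    = normq x1 *: rely x0 y0 x2 y2.
Proof.
move=> st; split.
  by rewrite /relx mulrA -(mulrA (conjq x0)) mulq_conjr mulr_algr -scalerAl.
rewrite /relx /rely mulrDr mulrDl !mulrA.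
rewrite -(mulrA (conjq x0) x1 (conjq x1)) -(mulrA (conjq y0) x1) mulq_conjr.
rewrite !mulr_algr -!scalerAl scalerDr -!addrA; congr (_ + _).
rewrite addrA -mulrDl -(mulrA _ x1) -(mulrA _ y1) -mulrDr st mulr0 mul0r add0r.
by [].
Qed.

Lemma relative_conj x0 y0 x1 y1 :
  conjq (relx x0 x1) = relx x1 x0 /\ conjq (rely x0 y0 x1 y1) = rely x1 y1 x0 y0.
Proof.
have cK (z : quat R) : conjq (conjq z) = z by quat_ring.
have cD (z z' : quat R) : conjq (z + z') = conjq z + conjq z' by quat_ring.
by rewrite /relx /rely cD !conjqM !cK addrC.
Qed.

Lemma product_scalar p n x y x' y' : y.1 = 0 -> y'.1 = 0 ->
    incidence x y p n = 0 -> incidence x' y' p n = 0 ->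
  (x * y' + y * x').1 = - pairing x.2 y.2 x'.2 y'.2 /\
  incidence (x * x') (x * y' + y * x') p n =
    product_incidence p n x.2 y.2 x'.2 y'.2.
Proof.
rewrite /incidence => y0 y0' i i'; split.
  by rewrite /= y0 y0' /pairing; ring.
transitivity (x.1 * incidence x' y' p n + x'.1 * incidence x y p n +
    product_incidence p n x.2 y.2 x'.2 y'.2); last first.
  by rewrite /incidence i i' !mulr0 !add0r.
rewrite /incidence /product_incidence /= y0 y0'.
by vec_ring.
Qed.

Lemma incidenceZ (a : R) x y p n :
  incidence (a *: x) (a *: y) p n = a * incidence x y p n.
Proof. by rewrite /incidence /= !dotZl mulrDr. Qed.

Lemma incidence_conj x y p n :
  incidence (conjq x) (conjq y) p n = - incidence x y p n.
Proof. by rewrite /incidence /= !dotNl opprD. Qed.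

(* The relative displacements from position 0 to position 2 by way of position *)
(* 1 and by way of position 3 coincide.                                        *)
Lemma closed_chain p n (x y : 'I_4 -> quat R) (p' n' : 'I_4 -> 'rV[R]_3) :
    (forall i, carries (x i) (y i) p n (p' i) (n' i)) ->
    let X i := relx (x i) (x (i + 1)) in
    let Y i := rely (x i) (y i) (x (i + 1)) (y (i + 1)) in
    (forall i, (Y i).1 = 0) -> (forall i, incidence (X i) (Y i) p n = 0) ->
  let G i := pairing (X i).2 (Y i).2 (X (i + 1)).2 (Y (i + 1)).2 in
  let H i := product_incidence p n (X i).2 (Y i).2 (X (i + 1)).2 (Y (i + 1)).2 in
  normq (x 3%:R) * G 0 = normq (x 1) * G 2%:R /\
  normq (x 3%:R) * H 0 = - (normq (x 1) * H 2%:R).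
Proof.
move=> hc X Y Y0 W0 G H.
have st i := carries_study (hc i).
have e1 : 0 + 1 = 1 :> 'I_4 by apply: val_inj.
have e2 : 1 + 1 = 2%:R :> 'I_4 by apply: val_inj.
have e3 : 2%:R + 1 = 3%:R :> 'I_4 by apply: val_inj.
have e4 : 3%:R + 1 = 0 :> 'I_4 by apply: val_inj.
have [g0 h0] := product_scalar (Y0 0) (Y0 (0 + 1)) (W0 0) (W0 (0 + 1)).
have [g2 h2] := product_scalar (Y0 2%:R) (Y0 (2%:R + 1)) (W0 2%:R) (W0 (2%:R + 1)).
have [m0 m0'] := relative_mul (x 0) (y 0) (x 2%:R) (y 2%:R) (st 1).
have [m2 m2'] := relative_mul (x 2%:R) (y 2%:R) (x 0) (y 0) (st 3%:R).
have [c1 c2] := relative_conj (x 0) (y 0) (x 2%:R) (y 2%:R).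
move: g0 h0 g2 h2; rewrite /G /H.
rewrite -!/(G _) -!/(H _) /X /Y !e1 !e2 !e3 !e4 m0 m0' m2 m2' !incidenceZ.
(* The way from position 2 back to position 0 is the conjugate, which keeps the scalar part and
   negates the incidence; hence the different signs in the two conclusions. *)
rewrite -c1 -c2 incidence_conj.
have fZ (a : R) (z : quat R) : (a *: z).1 = a * z.1 by [].
have fC (z : quat R) : (conjq z).1 = z.1 by [].
rewrite !fZ fC => g0 h0 g2 h2; split; last by rewrite -h0 -h2; ring.
rewrite -[G 0]opprK -g0 -[G 2%:R]opprK -g2; ring.
Qed.

(** Corresponding edges are parallel: they are g f and - e f for a common vector f. Each diagonal
    product is the sum of the edge products at two opposite corners, so both areas are combinations
    of f0 x f1 and f2 x f3. Since the two quadrilaterals close, these two are proportional, and the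
    last hypothesis is what is left to be shown. *)
Lemma quad_area (t : R) (q0 q1 q2 q3 m0 m1 m2 m3 : 'rV[R]_3)
    (e0 e1 e2 e3 g0 g1 g2 g3 : R) :
    e0 *: (q1 - q0) + g0 *: (m1 - m0) = 0 ->
    e1 *: (q2 - q1) + g1 *: (m2 - m1) = 0 ->
    e2 *: (q3 - q2) + g2 *: (m3 - m2) = 0 ->
    e3 *: (q0 - q3) + g3 *: (m0 - m3) = 0 ->
    g0 * e1 - e0 * g1 != 0 -> g2 * e3 - e2 * g3 != 0 ->
    (e0 * e1 + t ^+ 2 * (g0 * g1)) * (g2 * e3 - e2 * g3) +
    (e2 * e3 + t ^+ 2 * (g2 * g3)) * (g0 * e1 - e0 * g1) = 0 ->
  cross (m2 - m0) (m3 - m1) = - t ^+ 2 *: cross (q2 - q0) (q3 - q1).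
Proof.
have ex (e g : R) u v : e *: u + g *: v = 0 -> (e, g) != (0, 0) ->
    exists f, u = g *: f /\ v = - e *: f.
  move=> h nz; have [e00|e00] := eqVneq e 0.
    have g00 : g != 0 by apply: contraNneq nz => ->; rewrite e00.
    exists (g^-1 *: u); split; first by rewrite scalerA divff // scale1r.
    move/eqP: h; rewrite e00 scale0r add0r scaler_eq0 (negbTE g00) => /eqP ->.
    by rewrite oppr0 scale0r.
  exists (- e^-1 *: v); split; last by rewrite scalerA mulrNN divff // scale1r.
  apply: (scalerI e00).
  rewrite (_ : e *: u = - (g *: v)); last by apply/eqP; rewrite -addr_eq0 h.
  by rewrite !scalerA -scaleNr; congr (_ *: _); field.
move=> h0 h1 h2 h3 n01 n23 F.
have nz (a b c d : R) : a * d - c * b != 0 -> ((c, a) != (0, 0)) /\ ((d, b) != (0, 0)).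
  by move=> h; split; apply: contraNneq h => -[-> ->]; rewrite ?(mulr0, mul0r) subrr.
have [z0 z1] := nz _ _ _ _ n01; have [z2 z3] := nz _ _ _ _ n23.
have [f0 [u0 v0]] := ex _ _ _ _ h0 z0; have [f1 [u1 v1]] := ex _ _ _ _ h1 z1.
have [f2 [u2 v2]] := ex _ _ _ _ h2 z2; have [f3 [u3 v3]] := ex _ _ _ _ h3 z3.
have cl (a b c d : 'rV[R]_3) : (b - a) + (c - b) = - ((d - c) + (a - d)) by vec_ring.
have area (a b c d : 'rV[R]_3) : cross (c - a) (d - b) =
    cross (b - a) (c - b) + cross (d - c) (a - d) by vec_ring.
have Q := cl q0 q1 q2 q3; have M := cl m0 m1 m2 m3.
rewrite (area m0 m1 m2 m3) (area q0 q1 q2 q3).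
rewrite u0 u1 u2 u3 v0 v1 v2 v3 in Q M *.
have X : (g0 * e1 - e0 * g1) *: cross f0 f1 = (g2 * e3 - e2 * g3) *: cross f2 f3.
  transitivity (cross (- e0 *: f0 + - e1 *: f1) (g0 *: f0 + g1 *: f1)).
    by vec_ring.
  by rewrite Q M; vec_ring.
apply: (scalerI n23); apply/eqP; rewrite -subr_eq0; apply/eqP.
transitivity (((e0 * e1 + t ^+ 2 * (g0 * g1)) * (g2 * e3 - e2 * g3)) *: cross f0 f1
  + (e2 * e3 + t ^+ 2 * (g2 * g3)) *: ((g2 * e3 - e2 * g3) *: cross f2 f3)).
  by vec_ring.
by rewrite -X scalerA -scalerDl F scale0r.
Qed.


Lemma relative_normal x y x' y' p n p1 n1 p2 n2 :
    carries x y p n p1 n1 -> carries x' y' p n p2 n2 ->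
  conjq x * pure (n2 - n1) * x' = relx x x' * pure n - pure n * relx x x'.
Proof.
move=> [h _] [h' _]; rewrite pureD pureN mulrBr mulrBl (conjq_intertwine h).
by rewrite -mulrA h' /relx !mulrA.
Qed.

(** In homogeneous form, the hypothesis on e and g places the point p + (g / e) n on the relative
    axis; both positions send it to the same point. *)
Lemma relative_edge x y x' y' p n p1 n1 p2 n2 (e g : R) : x != 0 -> x' != 0 ->
    carries x y p n p1 n1 -> carries x' y' p n p2 n2 ->
    (rely x y x' y').1 = 0 ->
    e *: ((rely x y x' y').2 + cross (relx x x').2 p)
      + g *: cross (relx x x').2 n = 0 ->
  e *: (p2 - p1) + g *: (n2 - n1) = 0.
Proof.
move=> x0 x0' h h' Y1 eg.
have : conjq x * pure (e *: (p2 - p1) + g *: (n2 - n1)) * x' = 0.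
  rewrite pureD !pureZ mulrDr mulrDl -!scalerAr -!scalerAl.
  rewrite (relative_point h h') (relative_normal h h').
  move: (relx x x') (rely x y x' y') Y1 eg => X Y Y1 eg.
  rewrite commutator_pure.
  have -> : X * pure n - pure n * X = (0, 2 *: cross X.2 n) by quat_ring.
  rewrite qaddE !qscaleE /= Y1 !mulr0 addr0; congr (_, _).
  rewrite !(scalerA _ 2) !(mulrC _ 2) -!scalerA -scalerDr eg.
  exact: scaler0.
move/eqP; rewrite !mulq_eq0 (negbTE x0') orbF.
by rewrite -normq_eq0 normq_conj normq_eq0 (negbTE x0) => /eqP [].
Qed.

Lemma mated_pullback t C x y p n q m p' n' q' m' : x != 0 ->
    carries x y p n p' n' -> carries x y q m q' m' ->
    mated t C p' n' q' m' ->
  mated t C p n q m.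
Proof.
move=> x0 [hn hp] [hm hq] [c h].
have d : dot n m = dot n' m' by apply: (intertwine_dot x0).
split; first by rewrite d.
have E : pure (cross m' n') * x = x * pure (cross m n).
  have P u v : pure (cross u v) = pure u * pure v + (dot u v)%:A.
    by rewrite pureM subrK.
  rewrite !P mulrDl mulrDr -mulrA hn mulrA hm -!mulrA (dotC m) d (dotC n').
  by rewrite mulr_algl mulr_algr.
have F : x * pure (t *: (q - p) - cross m n) = 0.
  rewrite pureD pureN mulrBr -E -h !pureZ -scalerAl -scalerAr.
  rewrite !pureD !pureN mulrBr mulrBl hp hq opprD addrACA subrr addr0 subrr.
  by [].
move/eqP: F; rewrite mulq_eq0 (negbTE x0) /= => /eqP [/eqP].
by rewrite subr_eq0 => /eqP.
Qed.

Lemma generic_frame (e f : 'I_4 -> contact_element R) :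
    generic_positions e f ->
  exists (p k q l : 'rV[R]_3) (x y : 'I_4 -> quat R) (o v : 'I_4 -> 'rV[R]_3),
  [/\ dot k k = 1, dot l l = 1, two_transversals o v
     & forall i, Defs.skew (o i) (v i) (o (i + 1)) (v (i + 1))] /\
  forall i, [/\ x i != 0,
    carries (x i) (y i) p k (point (e i)) (normal (e i)),
    carries (x i) (y i) q l (point (f i)) (normal (f i))
  & exists2 r : R, r != 0 & (relx (x i) (x (i + 1))).2 = r *: v i /\
    (rely (x i) (y i) (x (i + 1)) (y (i + 1))).2 = cross (o i) (r *: v i)].
Proof.
move=> [[p k k1] [[q l l1] [A [o [v [/= hA hv ht hs]]]]]].
have [x hx] : exists x : 'I_4 -> quat R * quat R, forall i, (x i).1 != 0 /\
    forall p n, carries (x i).1 (x i).2 p n (displace (A i) p) (n *m linear_part (A i)).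
  have ex i : exists u : quat R * quat R, u.1 != 0 /\
      forall p n, carries u.1 u.2 p n (displace (A i) p) (n *m linear_part (A i)).
    by have [x [y h]] := displacement_rotor (A i); exists (x, y).
  exact: fin_all_exists ex.
exists p, k, q, l, (fun i => (x i).1), (fun i => (x i).2), o, v; split=> // i.
have [x0 h] := hx i; split=> //.
- by have [<- <- _ _] := hA i.
- by have [_ _ <- <-] := hA i.
have [r r0 [e1 e2]] := relative_axis x0 (proj1 (hx (i + 1))) h
  (proj2 (hx (i + 1))) (introN eqP (proj1 (hv i))) (proj2 (hv i)).
by exists r => //; rewrite -e1.
Qed.

Lemma pairingZ (a b : R) o v o' v' :
  pairing (a *: v) (cross o (a *: v)) (b *: v') (cross o' (b *: v')) =
  a * b * pairing v (cross o v) v' (cross o' v').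
Proof. by rewrite /pairing; vec_ring. Qed.

(* Both halves of the closed chain determine the ratio of product_incidence to *)
(* pairing; equating them gives the last hypothesis of quad_area.              *)
Lemma mate_area t C (e f : 'I_4 -> contact_element R) :
    t != 0 -> C ^+ 2 != 1 -> generic_positions e f ->
    (forall i, mated t C (point (e i)) (normal (e i)) (point (f i)) (normal (f i))) ->
    (forall i, common_tangent_sphere (e i) (e (i + 1))) ->
    (forall i, common_tangent_sphere (f i) (f (i + 1))) ->
  vector_area (fun i => normal (f i)) =
    - t ^+ 2 *: vector_area (fun i => point (f i)).
Proof.
move=> t0 C1 /generic_frame[p [k [q [l [x [y [o [v [[k1 l1 _ hs] hx]]]]]]]]] hm he hf.
have x0 i : x i != 0 by have [] := hx i.
pose X i := relx (x i) (x (i + 1)).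
pose Y i := rely (x i) (y i) (x (i + 1)) (y (i + 1)).
have he' i : carries (x i) (y i) p k (point (e i)) (normal (e i)) by have [] := hx i.
have hf' i : carries (x i) (y i) q l (point (f i)) (normal (f i)) by have [] := hx i.
have hm0 := mated_pullback (x0 0) (he' 0) (hf' 0) (hm 0).
have We i : (Y i).1 = 0 /\ incidence (X i) (Y i) p k = 0.
  by apply/(relative_tangent (x0 i) (x0 _) k1 (he' i) (he' _))/common_tangent_sphereP.
have Wf i : (Y i).1 = 0 /\ incidence (X i) (Y i) q l = 0.
  by apply/(relative_tangent (x0 i) (x0 _) l1 (hf' i) (hf' _))/common_tangent_sphereP.
have rs i : dot (X i).2 (Y i).2 = 0.
  by have [_ _ _ [r _ [-> ->]]] := hx i; rewrite dot_crossr.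
have G0 i : pairing (X i).2 (Y i).2 (X (i + 1)).2 (Y (i + 1)).2 != 0.
  have [_ _ _ [r r0 [-> ->]]] := hx i; have [_ _ _ [r' r0' [-> ->]]] := hx (i + 1).
  by rewrite pairingZ !mulf_neq0 // skew_pairing.
have hts i := axis_heights t0 C1 k1 l1 hm0 (proj2 (We i)) (proj2 (Wf i)) (rs i).
have hed i (a b : R) : a *: ((Y i).2 + cross (X i).2 q) + b *: cross (X i).2 l = 0 ->
    a *: (point (f (i + 1)) - point (f i)) + b *: (normal (f (i + 1)) - normal (f i)) = 0.
  exact: (relative_edge (x0 i) (x0 _) (hf' i) (hf' _) (proj1 (Wf i))).
have [cG cH] := closed_chain he' (fun i => proj1 (We i)) (fun i => proj2 (We i)).
have i1 : 0 + 1 = 1 :> 'I_4 by apply: val_inj.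
have i2 : 1 + 1 = 2%:R :> 'I_4 by apply: val_inj.
have i3 : 2%:R + 1 = 3%:R :> 'I_4 by apply: val_inj.
have i4 : 3%:R + 1 = 0 :> 'I_4 by apply: val_inj.
move: cG cH (G0 0) (G0 2%:R); rewrite -!/(X _) -!/(Y _) !i1 !i3.
have [a0 [b0 [g0 [h0 [r0 s0 /hed w0]]]]] := hts 0.
have [a1 [b1 [g1 [h1 [r1 s1 /hed w1]]]]] := hts 1.
have [a2 [b2 [g2 [h2 [r2 s2 /hed w2]]]]] := hts 2%:R.
have [a3 [b3 [g3 [h3 [r3 s3 /hed w3]]]]] := hts 3%:R.
have [P01 H01] := pairing_heights t0 C1 k1 l1 hm0 r0 s0 r1 s1.
have [P23 H23] := pairing_heights t0 C1 k1 l1 hm0 r2 s2 r3 s3.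
rewrite ?i1 ?i2 ?i3 ?i4 in w0 w1 w2 w3.
have nN i : normq (x i) != 0 by rewrite normq_eq0.
move: (nN 3%:R) (nN 1) P01 P23 H01 H23 => nN3 nN1.
move: (pairing _ _ _ _) (pairing _ _ _ _) => PB PA.
move: (product_incidence _ _ _ _ _ _) (product_incidence _ _ _ _ _ _) => HB HA.
move: (normq _) (normq _) nN3 nN1 => N1 N3 nN3 nN1 P01 P23 H01 H23 cG cH nPA nPB.
have D0 : 1 - C ^+ 2 != 0 by rewrite subr_eq0 eq_sym.
have nz (P s m : R) : P != 0 -> t * P = (1 - C ^+ 2) * (s * m) -> s != 0 /\ m != 0.
  move=> P0 eP; apply/andP; rewrite -negb_or -mulf_eq0.
  by apply: contraNneq P0 => sm0; move/eqP: eP; rewrite sm0 mulr0 mulf_eq0 (negbTE t0).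
have [nt01 nm01] := nz _ _ _ nPA P01; have [_ nm23] := nz _ _ _ nPB P23.
rewrite /vector_area [RHS]scalerA mulrC -scalerA; congr (_ *: _).
apply: (quad_area w0 w1 w2 w3 nm01 nm23).
move: nt01 P01 P23 H01 H23.
move: (b0 * h1 - b1 * h0) (b2 * h3 - b3 * h2) (g0 * a1 - a0 * g1) (g2 * a3 - a2 * g3) (a0 * a1 + _) (a2 * a3 + _).
move=> T U M M' Z Z' T0 P01 P23 H01 H23.
(* The height differences [T] and [U] on the first normal line cancel between [eG] and [eH], which
   leaves Z / M = - Z' / M'. *)
have eG : N3 * (T * M) = N1 * (U * M').
  by apply: (mulfI D0); rewrite (mulrCA _ N3) (mulrCA _ N1) -P01 -P23 mulrCA cG mulrCA.
have eH : N3 * (T * Z) = - (N1 * (U * Z')).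
  apply: (mulfI D0); rewrite mulrN (mulrCA _ N3) (mulrCA _ N1) -H01 -H23.
  by rewrite mulrCA cH mulrN mulrCA.
apply: (mulfI (mulf_neq0 nN3 T0)); rewrite mulr0.
transitivity ((N3 * (T * Z)) * M' + Z' * (N3 * (T * M))); first by ring.
by rewrite eG eH; ring.
Qed.


Lemma transversal_lineP (o v : 'I_4 -> 'rV[R]_3) p n :
    (forall i, dot (cross (o i) (v i)) n + dot (v i) (cross p n) = 0) ->
  (row_mx n (cross p n) <= transversal_space o v)%MS.
Proof.
move=> h; apply/sub_kermxP; rewrite mulmxA /klein_form mul_row_block.
rewrite !mulmx0 !mulmx1 add0r addr0; apply/rowP => i; rewrite mxE [RHS]mxE -[RHS](h i).
rewrite big_split_ord /= addrC; congr (_ + _).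
  rewrite dotC /dot mxE; apply: eq_bigr => j _.
  by rewrite row_mxEr mxE [in LHS]mxE /pluecker row_mxEr [(_^T) j 0]mxE.
rewrite dotC /dot mxE; apply: eq_bigr => j _.
rewrite row_mxEl; congr (_ * _).
by rewrite mxE [LHS]mxE /pluecker row_mxEl [RHS]mxE.
Qed.

(** The third contact element is rigidly attached to the figure of the first two, so the four axes
    meet its normal line as well. The transversal space has dimension two, but the three normal
    lines are linearly independent. *)
Lemma rigid_triple_not_generic t C1 C2 (a : R) (e f g : 'I_4 -> contact_element R) :
    t != 0 -> C1 ^+ 2 != 1 -> C1 != C2 -> a != 0 -> generic_positions e f ->
    (forall i, mated t C1 (point (e i)) (normal (e i)) (point (f i)) (normal (f i))) ->
    (forall i, common_tangent_sphere (e i) (e (i + 1))) ->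
    (forall i, common_tangent_sphere (f i) (f (i + 1))) ->
    (forall i, common_tangent_sphere (g i) (g (i + 1))) ->
    (forall i, point (g i) - point (e i) = a *: (point (f i) - point (e i))) ->
    (forall i, normal (g i) = (C2 - a * C1) *: normal (e i) + a *: normal (f i)) ->
  False.
Proof.
move=> t0 C1n C12 a0 /generic_frame[p [k [q [l [x [y [o [v [[k1 l1 [rk _] _] hx]]]]]]]]].
move=> hm he hf hg gp gn.
have x0 i : x i != 0 by have [] := hx i.
have he' i : carries (x i) (y i) p k (point (e i)) (normal (e i)) by have [] := hx i.
have hf' i : carries (x i) (y i) q l (point (f i)) (normal (f i)) by have [] := hx i.
have hm0 := mated_pullback (x0 0) (he' 0) (hf' 0) (hm 0).
pose c := p + a *: (q - p); pose m := (C2 - a * C1) *: k + a *: l.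
have hg' i : carries (x i) (y i) c m (point (g i)) (normal (g i)).
  have [hk hp] := he' i; have [hl hq] := hf' i; split.
    by rewrite gn /m !pureD !pureZ mulrDl mulrDr -!scalerAl -!scalerAr hk hl.
  have -> : point (g i) = point (e i) + a *: (point (f i) - point (e i)).
    by rewrite -gp addrC subrK.
  rewrite /c !(pureD, pureZ, pureN) !(mulrDl, mulrDr) -scalerAl -scalerAr.
  rewrite mulrDl mulrDr mulNr mulrN hp hq opprD addrACA subrr addr0.
  by rewrite addrAC.
have m1 : dot m m = 1.
  have [hn _] := hg' 0.
  by rewrite (intertwine_dot (x0 0) hn hn) normal_unit.
have W n r0 h (n1 : dot n n = 1)
    (hn : forall i, carries (x i) (y i) r0 n (point (h i)) (normal (h i)))
    (hh : forall i, common_tangent_sphere (h i) (h (i + 1))) :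
    (row_mx n (cross r0 n) <= transversal_space o v)%MS.
  apply: transversal_lineP => i.
  have := (relative_tangent (x0 i) (x0 (i + 1)) n1 (hn i) (hn (i + 1))).1
    ((common_tangent_sphereP _ _).1 (hh i)).
  have [_ _ _ [s s0 [e1 e2]]] := hx i; rewrite /incidence e1 e2 => -[_ e3].
  by apply: (mulfI s0); rewrite mulr0 -e3 crossZr !dotZl mulrDr.
have WK := W _ _ _ k1 he' he; have WL := W _ _ _ l1 hf' hf.
have WM := W _ _ _ m1 hg' hg.
set K := row_mx k _ in WK; set L := row_mx l _ in WL; set M := row_mx m _ in WM.
pose B := col_mx K (col_mx L M).
have sB : (B <= transversal_space o v)%MS.
  by rewrite !col_mx_sub WK WL WM.
have : ~~ row_free B.
  by rewrite -row_leq_rank -ltnNge (leq_ltn_trans (mxrankS sB)) // rk.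
rewrite -kermx_eq0 => /rowV0Pn[u /sub_kermxP uB u0].
have [r1 [r2 [r3 eu]]] : exists r1 r2 r3 : R,
    u = row_mx r1%:M (row_mx r2%:M r3%:M :> 'rV_(1 + 1)).
  exists (lsubmx u 0 0), (lsubmx (rsubmx u) 0 0), (rsubmx (rsubmx u) 0 0).
  by rewrite -!mx11_scalar !hsubmxK.
move: uB; rewrite eu !mul_row_col !mul_scalar_mx !scale_row_mx !add_row_mx.
rewrite -[0]row_mx0 => /eq_row_mx[]; rewrite !addrA => uk um.
have [kl tw] := hm0; have [wk wl] := mated_perp t0 hm0.
have D0 : 1 - C1 ^+ 2 != 0 by rewrite subr_eq0 eq_sym.
have indep (s s' : R) : s *: k + s' *: l = 0 -> s = 0 /\ s' = 0.
  move=> e0; have ek : s + s' * C1 = 0.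
    by rewrite -(dot0r k) -e0 !dot_linear k1 kl mulr1.
  have el : s * C1 + s' = 0.
    by rewrite -(dot0r l) -e0 !dot_linear l1 (dotC l) kl mulr1.
  have : (1 - C1 ^+ 2) * s' = 0.
    rewrite -[RHS](subrr 0) -{1}el -(mulr0 C1) -ek; ring.
  move/eqP; rewrite mulf_eq0 (negbTE D0) => /eqP s'0.
  by move: ek; rewrite s'0 mul0r addr0.
have [e1 e2] : r1 + r3 * (C2 - a * C1) = 0 /\ r2 + r3 * a = 0.
  by apply: indep; rewrite -uk /m; vec_ring.
have [e3 e4] : r3 * a * (C2 - a * C1) = 0 /\ r3 * a * (a - 1) = 0.
  apply: indep.
  set V := _ + _.
  have wV : cross (q - p) V = 0.
    have -> : V = r2 *: l + (r3 * a) *: m.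
      by rewrite (_ : r2 = - (r3 * a)) /V /m; [vec_ring | apply/eqP; rewrite -addr_eq0 e2].
    rewrite -[RHS](subrr 0) -{1}um -(_ : cross p 0 = 0); last by vec_ring.
    by rewrite -uk /c; vec_ring.
  have Vw : dot (q - p) V = 0 by rewrite /V dotDr !dotZr wk wl !mulr0 addr0.
  have := cross_crossr (q - p) (q - p) V; rewrite wV Vw scale0r sub0r.
  rewrite (_ : cross _ 0 = 0); last by vec_ring.
  move/esym/eqP; rewrite oppr_eq0 scaler_eq0 => /orP[|/eqP //].
  have := mated_norm k1 l1 hm0 => h /eqP e0; move: h; rewrite e0 mulr0.
  by move=> h; move: D0; rewrite -h eqxx.
(* Otherwise a = 1 and C2 = a C1, contrary to C1 != C2. *)
have r30 : r3 = 0.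
  apply/eqP; apply: contraNT C12 => r30; move/eqP: e4; move/eqP: e3.
  rewrite !mulf_eq0 (negbTE r30) (negbTE a0) /= !subr_eq0 => /eqP -> /eqP ->.
  by rewrite mul1r.
move/eqP: u0; apply; rewrite eu.
have -> : r1 = 0 by rewrite -e1 r30 mul0r addr0.
have -> : r2 = 0 by rewrite -e2 r30 mul0r addr0.
by rewrite r30 !raddf0 !row_mx0.
Qed.

End Heights.

(** * The fourth net *)

Section MateElements.
Variable R : realType.
Implicit Types (e f : contact_element R) (n m u w : 'rV[R]_3) (t delta phi : R).

(** The last condition on mates makes the connecting line perpendicular to both normals. It also
    excludes sin phi = 0, where the tangent planes would coincide. *)
Lemma mate_elements_mated delta phi e f : mate_elements delta phi e f ->
  [/\ 0 < delta, sin phi != 0 &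
      mated (sin phi / delta) (cos phi) (point e) (normal e) (point f) (normal f)].
Proof.
case: e f => [p n n1] [q m m1]; rewrite /mate_elements /on_tangent_plane /=.
move=> [hd ha pq hpl].
have w0 : q - p != 0 by rewrite subr_eq0 eq_sym; apply/eqP.
have d0 : 0 < delta by rewrite -hd lt_def enorm_eq0 w0 enorm_ge0.
have [h1 h2] : dot (q - p) n = 0 /\ dot (p - p) m + dot (p - q) m = 0.
  split; first by apply: (proj1 (proj2 (hpl q) _)); exists 1; vec_ring.
  rewrite subrr dot0l add0r.
  by apply: (proj2 (proj2 (hpl p) _)); exists 0; vec_ring.
have eu : direction p q = delta^-1 *: (q - p) by rewrite /direction hd.
rewrite /oriented_angle eu in ha.
have s0 : sin phi != 0.
  apply/eqP => s0; move: ha; rewrite s0 scale0r addr0 => ha.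
  have c0 : cos phi != 0.
    by apply/eqP => c0; move: (cos2Dsin2 phi); rewrite s0 c0 expr0n addr0 => /eqP;
       rewrite eq_sym oner_eq0.
  (* For parallel normals, this quarter turn of q - p gives a point of both planes off the
     connecting line. *)
  have [t] : on_line p (q - p) (p + cross n (q - p)).
    apply/hpl; rewrite addrAC subrr add0r ha !dotZr; split.
      by rewrite dotC dot_crossl.
    rewrite (_ : p + _ - q = cross n (q - p) - (q - p)); last by vec_ring.
    by rewrite dotDl dotNl h1 dotC dot_crossl subrr mulr0.
  move=> /(congr1 (fun v => v - p)); rewrite ![p + _]addrC !addrK => ht.
  have : dot (cross n (q - p)) (cross n (q - p)) = 0.
    by rewrite {1}ht dotZl dot_crossr mulr0.
  rewrite dot_cross_cross n1 mul1r (dotC n) h1 mul0r subr0 => /eqP.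
  by rewrite dotvv_eq0 (negbTE w0).
split=> //; split.
  by rewrite {1}ha crossZr !dot_linear n1 dot_crossl !mulr0 addr0 mulr1.
rewrite {1}ha crossDl !crossZl crossvv scaler0 add0r crossZr crossZl cross_crossl.
by rewrite n1 h1 scale0r subr0 scale1r !scalerA.
Qed.

Lemma mated_mate_elements delta phi e f : 0 < delta -> sin phi != 0 ->
    mated (sin phi / delta) (cos phi) (point e) (normal e) (point f) (normal f) ->
  mate_elements delta phi e f.
Proof.
case: e f => [p n n1] [q m m1] /= d0 s0 h.
have t0 : sin phi / delta != 0 by rewrite mulf_neq0 // invr_eq0 lt0r_neq0.
have [h1 h2] := mated_perp t0 h.
have h3 := mated_norm n1 m1 h.
case: h => nm h.
have dd : enorm (q - p) = delta.
  apply/eqP; rewrite -(eqrXn2 (n := 2)) ?enorm_ge0 ?ltW // enorm_sqr.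
  have d2 : delta ^+ 2 != 0 by rewrite expf_neq0 ?lt0r_neq0.
  have s2 : sin phi ^+ 2 != 0 by rewrite expf_neq0.
  apply/eqP/(mulfI s2)/(mulIf (invr_neq0 d2)).
  move: h3; rewrite -sin2cos2 expr_div_n mulrAC => ->.
  by rewrite mulfK.
have ha : m = cos phi *: n + sin phi *: cross n (direction p q).
  rewrite /direction dd crossZr scalerA -crossZr h cross_crossr n1 nm scale1r.
  by rewrite addrC subrK.
have w0 : q - p != 0 by rewrite -enorm_eq0 dd lt0r_neq0.
rewrite /mate_elements /on_tangent_plane /=; split=> //.
  by move=> e; move: w0; rewrite e subrr eqxx.
move=> x; split; last first.
  move=> [s ->]; rewrite addrAC subrr add0r dotZl h1 mulr0; split=> //.
  rewrite (_ : p + _ - q = (s - 1) *: (q - p)); last by vec_ring.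
  by rewrite dotZl h2 mulr0.
move=> [x1 x2].
have x3 : dot (x - p) m = 0.
  have -> : x - p = (x - q) + (q - p) by rewrite addrA subrK.
  by rewrite dotDl x2 h2 addr0.
have [s es] : exists s : R, x - p = s *: (q - p).
  apply: cross_eq0 => //; apply: (scalerI t0); rewrite scaler0 -crossZr h.
  by rewrite cross_crossr x1 x3 !scale0r subr0.
by exists s; rewrite -es addrC subrK.
Qed.

(** The normal lines are not parallel, so p and q are the feet of their only common
    perpendicular. *)
Lemma mated_twist phi delta tau e f : 0 < delta -> sin phi != 0 ->
    mate_elements delta phi e f ->
    twist (point e) (normal e) (point f) (normal f) tau ->
  tau = sin phi / delta.
Proof.
move=> d0 s0 hm; have [_ _ hmm] := mate_elements_mated hm.
case: e f hm hmm => [p n n1] [q m m1] /= [/= hd ha _ _] hmm.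
have t0 : sin phi / delta != 0 by rewrite mulf_neq0 // invr_eq0 lt0r_neq0.
have [h1 h2] := mated_perp t0 hmm; have [nm hx] := hmm.
move=> [x [y [phi' [[[r ->] [s ->]] _ [e1 e2] ha' ->]]]].
have E : q + s *: m - (p + r *: n) = (q - p) + s *: m - r *: n by vec_ring.
have D v w : dot (w + s *: m - r *: n) v = dot w v + s * dot m v - r * dot n v.
  by rewrite !dot_linear.
have c1 : 1 - cos phi ^+ 2 != 0 by rewrite -sin2cos2 expf_neq0.
have f1 : s * cos phi = r.
  by move: e1; rewrite E D h1 n1 (dotC m) nm => e1; lra.
have f2 : s = r * cos phi.
  by move: e2; rewrite E D h2 m1 nm => e2; lra.
have s00 : s = 0.
  by apply/(mulIf c1); rewrite mul0r mulrBr mulr1 expr2 mulrA f1 -f2 subrr.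
have r00 : r = 0 by rewrite -f1 s00 mul0r.
move: ha'; rewrite E r00 s00 !scale0r !addr0 subr0 hd => ha'.
congr (_ / _).
have : dot (cross n (direction p q)) m = dot (cross n (direction p q)) m by [].
rewrite {1}ha' {1}ha !dot_linear.
rewrite (dotC _ n) dot_crossl !mulr0 !add0r => /mulIf; apply.
rewrite dotvv_eq0; apply: contraNneq s0 => c0.
move: m1; rewrite ha c0 scaler0 addr0 !dot_linear n1 mulr1 -expr2 => c2.
by rewrite -sqrf_eq0 sin2cos2 c2 subrr.
Qed.

Lemma contact_element_eq e f : point e = point f -> normal e = normal f -> e = f.
Proof.
case: e f => [p n n1] [q m m1] /= e1 e2; move: n1 m1; rewrite e1 e2 => n1 m1.
by rewrite (eq_irrelevance n1 m1).
Qed.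

End MateElements.

(** * Solutions at a single index *)

Section FourthElement.
Variable R : realType.
Implicit Types (a b c d k l m n p q u v w : 'rV[R]_3) (t C : R).

Lemma unit_dot_eq1 u v : dot u u = 1 -> dot v v = 1 -> dot u v = 1 -> u = v.
Proof.
move=> u1 v1 uv; apply/eqP; rewrite -subr_eq0 -dotvv_eq0 !dot_linear.
by rewrite u1 v1 (dotC v) uv; apply/eqP; ring.
Qed.

(* n is the image of k under the reflection in the plane orthogonal to l - m.  *)
Lemma fourth_mated t C1 C2 a k b l c m (r : R) : t != 0 ->
    dot k k = 1 -> dot l l = 1 -> dot m m = 1 -> dot l m != 1 ->
    mated t C1 a k b l -> mated t C2 a k c m ->
    r = (C2 - C1) / (1 - dot l m) ->
  let n := k + r *: (l - m) in let d := a + (r / t) *: cross l m in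
  [/\ dot n n = 1, mated t C2 b l d n & mated t C1 c m d n].
Proof.
move=> t0 k1 l1 m1 lm [kl ab] [km ac] er n d.
have e0 : 1 - dot l m != 0 by rewrite subr_eq0 eq_sym.
have re : r * (1 - dot l m) = C2 - C1 by rewrite er divfK.
have ln : dot l n = C2.
  rewrite !dot_linear l1 (dotC l k) kl -[RHS](subrK C1) -re; ring.
have mn : dot m n = C1.
  rewrite !dot_linear m1 (dotC m k) km (dotC m l) -[RHS](subKr C2) -re; ring.
have ad : t *: (d - a) = r *: cross l m.
  by rewrite /d addrAC subrr add0r scalerA mulrC divfK.
split; last 2 first.
- split=> //; rewrite (_ : d - b = (d - a) - (b - a)); last by vec_ring.
  by rewrite scalerBr ad ab /n; vec_ring.
- split=> //; rewrite (_ : d - c = (d - a) - (c - a)); last by vec_ring.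
  by rewrite scalerBr ad ac /n; vec_ring.
rewrite {1}/n !dotDl dotZl !dotDl dotNl ln mn /n !dot_linear k1 kl km.
by ring.
Qed.

(** The two ways from a to d give (n - k) x (l - m) = 0, hence n = k + s (l - m); then |n| = 1 is a
    quadratic equation for s with root 0. *)
Lemma fourth_unique t C1 C2 C C' a k b l c m d n : t != 0 ->
    dot k k = 1 -> dot l l = 1 -> dot m m = 1 -> dot n n = 1 ->
    dot l m != 1 ->
    mated t C1 a k b l -> mated t C2 a k c m ->
    mated t C b l d n -> mated t C' c m d n ->
  n = k \/ n = k + ((C2 - C1) / (1 - dot l m)) *: (l - m).
Proof.
move=> t0 k1 l1 m1 n1 lm [kl ab] [km ac] [ln bd] [mn cd].
have X : cross (n - k) (l - m) = 0.
  have : t *: (d - b) + t *: (b - a) = t *: (d - c) + t *: (c - a) by vec_ring.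
  rewrite ab ac bd cd => /eqP; rewrite -subr_eq0 => /eqP e.
  by rewrite -e; vec_ring.
have lm0 : l - m != 0.
  by apply: contraNneq lm => /eqP; rewrite subr_eq0 => /eqP <-; apply/eqP.
have [s es] := cross_eq0 lm0 X.
have en : n = k + s *: (l - m) by rewrite -es addrC subrK.
have e0 : 1 - dot l m != 0 by rewrite subr_eq0 eq_sym.
have : s * (s * (1 - dot l m) - (C2 - C1)) = 0.
  move: n1; rewrite en !dot_linear k1 l1 m1 (dotC m l) (dotC l k) (dotC m k) kl km.
  by move: (dot l m) => x e; lra.
move/eqP; rewrite mulf_eq0 => /orP[/eqP s0|].
  by left; rewrite en s0 scale0r addr0.
by rewrite subr_eq0 => /eqP h; right; rewrite en -h mulfK.
Qed.

(* With opposite twists on the two sides, all four lines are orthogonal to a   *)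
(* common line.                                                                *)
Lemma opposite_twist t C1 C2 C C' a k b l c m d n : t != 0 ->
    dot k k = 1 -> dot l l = 1 -> dot m m = 1 -> dot n n = 1 ->
    C1 ^+ 2 != 1 -> C ^+ 2 != 1 ->
    mated t C1 a k b l -> mated t C2 a k c m ->
    mated t C b l d n -> mated (- t) C' c m d n ->
  exists s x : R, [/\ c - a = s *: (b - a), m = (C2 - s * C1) *: k + s *: l,
    s ^+ 2 * (1 - C1 ^+ 2) = 1 - C2 ^+ 2, x ^+ 2 * (1 - C1 ^+ 2) = 1 - C ^+ 2
    & (1 + C * C2) - x * (1 + C1 * C2) - s * (1 + C1 * C)
      - x * s * (1 - C1 ^+ 2) = 0].
Proof.
move=> t0 k1 l1 m1 n1 C1n Cn [kl ab] [km ac] [ln bd] [mn cd].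
have D0 : 1 - C1 ^+ 2 != 0 by rewrite subr_eq0 eq_sym.
have X : cross l k + cross n l - cross m k + cross n m = 0.
  rewrite -ab -bd -ac -[cross n m]opprK -cd; vec_ring.
have dX u : dot u (cross l k + cross n l - cross m k + cross n m) = 0.
  by rewrite X dot0r.
(* The scalar products of [X] with l + m and l - m isolate the two determinants. *)
have det1 : dot m (cross k l) = 0.
  have := dX (l + m); set Z := dot _ _ => Z0.
  have : Z = - 2 * dot m (cross k l) by rewrite /Z; vec_ring.
  by rewrite Z0; lra.
have det2 : dot n (cross l m) = 0.
  have := dX (l - m); set Z := dot _ _ => Z0.
  have : Z = - 2 * dot n (cross l m) by rewrite /Z; vec_ring.
  by rewrite Z0; lra.
have kl2 : dot (cross k l) (cross k l) = 1 - C1 ^+ 2.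
  by rewrite dot_cross_cross k1 l1 (dotC l) kl; ring.
have span u : dot u (cross k l) = 0 -> exists r s : R, u = r *: k + s *: l.
  move=> u0; exists (dot (cross u l) (cross k l) / (1 - C1 ^+ 2)).
  exists (dot (cross k u) (cross k l) / (1 - C1 ^+ 2)).
  apply: (scalerI D0); rewrite scalerDr !scalerA ![_ * (_ / _)]mulrC !divfK //.
  rewrite -kl2 -[RHS]addr0 -(scale0r (cross k l)) -u0; vec_ring.
have [r [s em]] := span _ det1.
have er : r = C2 - s * C1.
  by rewrite -km em !dot_linear k1 kl; ring.
have [x [y en]] : exists x y : R, n = x *: k + y *: l.
  (* If r = 0, then m is a multiple of l and [det2] is void; the products of [X] with k and n
     replace it. *)
  apply: span; have [r0|r0] := eqVneq r 0; last first.
    apply: (mulfI r0); rewrite mulr0 -[RHS]oppr0 -det2 em; vec_ring.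
  have := dX n; have := dX k; rewrite em r0 scale0r add0r.
  set Z := dot k _; set W := dot n (cross l k + _ - _ + _) => Z0 W0.
  have : Z + W = - 2 * dot n (cross k l) by rewrite /Z /W; vec_ring.
  by rewrite Z0 W0; lra.
have ey : y = C - x * C1.
  by rewrite -ln en !dot_linear l1 (dotC l) kl; ring.
exists s, x; split.
- apply: (scalerI t0); rewrite ac scalerA mulrC -scalerA ab em.
  by vec_ring.
- by rewrite -er.
- have : dot m m = r ^+ 2 + s ^+ 2 + 2 * (r * s * C1).
    by rewrite em !dot_linear k1 l1 (dotC l) kl; ring.
  by rewrite m1 er => h; lra.
- have : dot n n = x ^+ 2 + y ^+ 2 + 2 * (x * y * C1).
    by rewrite en !dot_linear k1 l1 (dotC l) kl; ring.
  by rewrite n1 ey => h; lra.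
have : (1 - x - s - (x * s - y * r)) *: cross l k = 0.
  by rewrite -X em en; vec_ring.
move/eqP; rewrite scaler_eq0 => /orP[/eqP h|/eqP lk0].
  by rewrite -h er ey; ring.
by move: D0; rewrite -kl2 crossC lk0 oppr0 dot0l eqxx.
Qed.

(** The constants determine s and x up to sign; this excludes a change of sign of s between two
    indices. Adding and subtracting the two relations yields C = - C1 if x' = x and C = - C2 if x' =
    - x, and then 2 = 0 or 2 s = 0. *)
Lemma opposite_ratio (C1 C2 C s x x' : R) : C1 ^+ 2 != 1 -> C2 ^+ 2 != 1 ->
    s ^+ 2 * (1 - C1 ^+ 2) = 1 - C2 ^+ 2 ->
    x ^+ 2 * (1 - C1 ^+ 2) = 1 - C ^+ 2 ->
    x' ^+ 2 * (1 - C1 ^+ 2) = 1 - C ^+ 2 ->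
    (1 + C * C2) - x * (1 + C1 * C2) - s * (1 + C1 * C)
      - x * s * (1 - C1 ^+ 2) = 0 ->
    (1 + C * C2) - x' * (1 + C1 * C2) + s * (1 + C1 * C)
      + x' * s * (1 - C1 ^+ 2) = 0 ->
  False.
Proof.
move=> C1n C2n hs hx hx' E E'.
have D0 : 1 - C1 ^+ 2 != 0 by rewrite subr_eq0 eq_sym.
have s0 : s != 0.
  apply: contraNneq C2n => s0; move: hs; rewrite s0 expr0n mul0r => /esym/eqP.
  by rewrite subr_eq0 eq_sym.
have : x' ^+ 2 = x ^+ 2 by apply: (mulIf D0); rewrite hx hx'.
move/eqP; rewrite eqf_sqr => /orP[/eqP ex|/eqP ex]; rewrite ex in E'.
  have e1 : s * ((1 + C1 * C) + x * (1 - C1 ^+ 2)) = 0 by lra.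
  have e2 : 1 + C * C2 = x * (1 + C1 * C2) by lra.
  move/eqP: e1; rewrite mulf_eq0 (negbTE s0) /= => /eqP e1.
  have : (C1 + C) ^+ 2 = 0.
    transitivity ((1 + C1 * C) ^+ 2 - (1 - C1 ^+ 2) * (1 - C ^+ 2)); first by ring.
    rewrite -hx (_ : 1 + C1 * C = - (x * (1 - C1 ^+ 2))); first by ring.
    by apply/eqP; rewrite -addr_eq0 e1.
  move/eqP; rewrite sqrf_eq0 addrC addr_eq0 => /eqP eC.
  have x1 : x = - 1.
    by apply: (mulIf D0); move: e1; rewrite eC; lra.
  by move: e2; rewrite eC x1; lra.
have e1 : 1 + C * C2 = x * s * (1 - C1 ^+ 2) by lra.
have e2 : x * (1 + C1 * C2) = - (s * (1 + C1 * C)) by lra.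
have : (C + C2) ^+ 2 = 0.
  transitivity ((1 + C * C2) ^+ 2 - (1 - C ^+ 2) * (1 - C2 ^+ 2)); first by ring.
  by rewrite -hx -hs e1; ring.
move/eqP; rewrite sqrf_eq0 addr_eq0 => /eqP eC.
have xs : x = s.
  apply: (mulIf s0); apply: (mulIf D0); rewrite -e1 -expr2 hs eC; ring.
have : s * 2 = 0 by move: e2; rewrite xs eC; lra.
by move/eqP; rewrite mulf_eq0 (negbTE s0) pnatr_eq0.
Qed.

End FourthElement.

Section FourthNet.
Variables (R : realType) (s : nat).
Implicit Types (X Y Z W : net R s) (t C : R) (i : 'rV[int]_s) (j k : 'I_s).

Definition net_mated t C X Y : Prop := forall i,
  mated t C (point (X i)) (normal (X i)) (point (Y i)) (normal (Y i)).

Lemma net_mated_sym t C X Y : net_mated t C X Y -> net_mated t C Y X.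
Proof. by move=> h i; apply: mated_sym. Qed.

(** This change of sign is what the identification in [same_net] absorbs. *)
Lemma net_mated_reverse t C X Y : net_mated t C X Y ->
  net_mated (- t) (- C) X (fun i => reverse (Y i)).
Proof.
move=> h i; have [c e] := h i; split; first by rewrite dotNr c.
by rewrite scaleNr e crossNl.
Qed.

Lemma mates_with_net_mated delta phi X Y : mates_with delta phi X Y ->
  [/\ 0 < delta, sin phi != 0 & net_mated (sin phi / delta) (cos phi) X Y].
Proof.
move=> h; have [d0 s0 _] := mate_elements_mated (h 0); split=> // i.
by have [_ _] := mate_elements_mated (h i).
Qed.

Lemma net_mated_mates_with delta phi X Y : 0 < delta -> sin phi != 0 ->
  net_mated (sin phi / delta) (cos phi) X Y -> mates_with delta phi X Y.
Proof. by move=> d0 s0 h i; apply: mated_mate_elements. Qed.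

Lemma cos_neq1 (phi : R) : sin phi != 0 -> cos phi ^+ 2 != 1.
Proof. by move=> s0; rewrite eq_sym -subr_eq0 -sin2cos2 expf_neq0. Qed.

Lemma quad_common_sphere X i j k : principal X -> forall r : 'I_4,
  common_tangent_sphere (quad X i j k r) (quad X i j k (r + 1)).
Proof.
move=> hX r; rewrite /quad.
have e : shift (shift i k) j = shift (shift i j) k by rewrite /shift addrAC.
case: r => [[|[|[|[|//]]]] h] /=.
- exact: hX.
- exact: hX.
- by rewrite -e; apply: common_tangent_sphere_sym.
- by apply: common_tangent_sphere_sym.
Qed.

Lemma generic_positions_sym (e f : 'I_4 -> contact_element R) :
  generic_positions e f -> generic_positions f e.
Proof.
move=> [e0 [f0 [A [o [v [h1 h2 h3 h4]]]]]]; exists f0, e0, A, o, v; split=> // r.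
by have [a b c d] := h1 r; split.
Qed.

Lemma two_directions : (2 <= s)%N -> exists j k : 'I_s, j != k.
Proof. by move=> s2; exists (Ordinal (ltnW s2)), (Ordinal s2). Qed.

(** Both pairs compute the ratio of the vector areas of the shared net [Y], once as -t^2 and once as
    -t'^2. *)
Lemma net_twist_determined t C t' C' X Y Z : (2 <= s)%N ->
    t != 0 -> C ^+ 2 != 1 -> t' != 0 -> C' ^+ 2 != 1 ->
    principal X -> principal Y -> principal Z ->
    net_mated t C X Y -> net_mated t' C' Y Z -> curvature_defined Y ->
    generic_mates X Y -> generic_mates Y Z ->
  t ^+ 2 = t' ^+ 2.
Proof.
move=> /two_directions[j [k jk]] t0 C1 t0' C1' hX hY hZ XY YZ cY gXY gYZ.
have [K [/eqP v0 _]] := cY 0 j k jk.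
have A1 := mate_area t0 C1 (gXY 0 j k jk) (fun r => XY _)
  (quad_common_sphere 0 j k hX) (quad_common_sphere 0 j k hY).
have A2 := mate_area t0' C1' (generic_positions_sym (gYZ 0 j k jk))
  (fun r => net_mated_sym YZ _)
  (quad_common_sphere 0 j k hZ) (quad_common_sphere 0 j k hY).
apply: oppr_inj; apply/eqP; rewrite -subr_eq0.
have : (- t ^+ 2 - - t' ^+ 2) *: vector_area (fun r => point (quad Y 0 j k r)) = 0.
  by rewrite scalerBl -A1 -A2 subrr.
by move/eqP; rewrite scaler_eq0 (negbTE v0) orbF.
Qed.

Lemma mated_point_unique t C C' (p n q q' m : 'rV[R]_3) : t != 0 ->
  mated t C p n q m -> mated t C' p n q' m -> q = q'.
Proof.
move=> t0 [_ h] [_ h'].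
have : q - p = q' - p by apply: (scalerI t0); rewrite h h'.
by move/addIr.
Qed.

Section Construction.
Variables (t C1 C2 : R) (ak bl cm : net R s).
Hypotheses (t0 : t != 0) (C1n : C1 ^+ 2 != 1) (C2n : C2 ^+ 2 != 1)
  (C12 : C1 != C2) (ab : net_mated t C1 ak bl) (ac : net_mated t C2 ak cm).
Hypotheses (a_pr : principal ak) (b_pr : principal bl) (c_pr : principal cm).

Let lm i := dot (normal (bl i)) (normal (cm i)).

Lemma transforms_not_parallel i : lm i != 1.
Proof.
apply: contraNneq C12 => h.
have e := unit_dot_eq1 (normal_unit (bl i)) (normal_unit (cm i)) h.
by rewrite -(proj1 (ab i)) e (proj1 (ac i)).
Qed.

Let r i := (C2 - C1) / (1 - lm i).

Lemma fourth_normal_unit i :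
  let n := normal (ak i) + r i *: (normal (bl i) - normal (cm i)) in dot n n = 1.
Proof.
by have [] := fourth_mated t0 (normal_unit (ak i)) (normal_unit (bl i))
  (normal_unit (cm i)) (transforms_not_parallel i) (ab i) (ac i) (erefl (r i)).
Qed.

Definition fourth : net R s := fun i => ContactElement
  (point (ak i) + (r i / t) *: cross (normal (bl i)) (normal (cm i)))
  (fourth_normal_unit i).

Lemma fourth_mated_both : net_mated t C2 bl fourth /\ net_mated t C1 cm fourth.
Proof.
by split=> i; have [_ bd cd] := fourth_mated t0 (normal_unit (ak i))
  (normal_unit (bl i)) (normal_unit (cm i)) (transforms_not_parallel i)
  (ab i) (ac i) (erefl (r i)).
Qed.

Lemma fourth_principal : principal fourth.
Proof.
move=> i j; apply/common_tangent_sphereP.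
have [bd cd] := fourth_mated_both.
have u := @normal_unit R.
have en i' : (1 - lm i') *: (normal (fourth i') - normal (ak i')) =
    (C2 - C1) *: (normal (bl i') - normal (cm i')).
  rewrite /= addrAC subrr add0r scalerA mulrC divfK // subr_eq0 eq_sym.
  exact: transforms_not_parallel.
apply: (fourth_tangent t0 C1n C2n (u _) (u _) (u _) (u _) (u _) (u _) (u _) (u _)
  (ab i) (ac i) (bd i) (cd i) (ab _) (ac _) (bd _) (cd _) (en i) (en _)
  (transforms_not_parallel i) (transforms_not_parallel _)).
all: by apply/common_tangent_sphereP.
Qed.

(** Equality with [ak] would identify the two cosines; equality with its reversal would give b and a
    both twists t and -t, hence parallel normals. *)
Lemma fourth_not_same : ~ same_net ak fourth.
Proof.
have [bd _] := fourth_mated_both.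
case=> /(_ 0) e; have [c1 h1] := bd 0; have [c2 h2] := ab 0; rewrite e in c1 h1.
  by case/eqP: C12; rewrite -c1 -c2 dotC.
move: c1 h1 => /= c1 h1.
have lk0 : cross (normal (bl 0)) (normal (ak 0)) = 0.
  have : t *: (point (ak 0) - point (bl 0)) + t *: (point (bl 0) - point (ak 0)) =
      2 *: cross (normal (bl 0)) (normal (ak 0)) by rewrite h1 h2; vec_ring.
  rewrite -scalerDr addrA subrK subrr scaler0 => /esym/eqP.
  by rewrite scaler_eq0 pnatr_eq0 => /eqP.
have := dot_cross_cross (normal (bl 0)) (normal (ak 0)) (normal (bl 0)) (normal (ak 0)).
rewrite lk0 dot0l !normal_unit (dotC (normal (bl 0))) c2 mulr1 -expr2 => /esym/eqP.
by rewrite subr_eq0 eq_sym (negbTE C1n).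
Qed.

(** [fourth_unique] leaves a choice at each index; the constant [C], which is [C1] for [ak] and [C2]
    for [fourth], decides it for all indices at once. *)
Lemma fourth_net_unique C C' W : net_mated t C bl W -> net_mated t C' cm W ->
  (forall i, W i = ak i) \/ (forall i, W i = fourth i).
Proof.
move=> bW cW; have [bd cd] := fourth_mated_both.
have alt i : normal (W i) = normal (ak i) \/ normal (W i) = normal (fourth i).
  exact: (fourth_unique t0 (normal_unit (ak i)) (normal_unit (bl i))
    (normal_unit (cm i)) (normal_unit (W i)) (transforms_not_parallel i)
    (ab i) (ac i) (bW i) (cW i)).
have eqn X D i : net_mated t D bl X -> normal (W i) = normal (X i) -> W i = X i.
  move=> bX e; apply: contact_element_eq => //.
  by have := bX i; rewrite -e => /(mated_point_unique t0 (bW i)).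
have ba := net_mated_sym ab.
have [eC|nC] := eqVneq C C1.
  left=> i; case: (alt i) => [|e]; first exact: eqn ba.
  by case/eqP: C12; rewrite -eC -(proj1 (bW i)) e (proj1 (bd i)).
right=> i; case: (alt i) => [e|]; last exact: eqn bd.
by case/eqP: nC; rewrite -(proj1 (bW i)) e (proj1 (ba i)).
Qed.

(** By [opposite_ratio] the ratio in which c divides a and b is the same at all indices, so a, b, c
    move rigidly and [rigid_triple_not_generic] applies. *)
Lemma no_opposite_transform C C' W : (2 <= s)%N -> C ^+ 2 != 1 ->
    generic_mates ak bl -> net_mated t C bl W -> net_mated (- t) C' cm W -> False.
Proof.
move=> /two_directions[j [k jk]] Cn gab bW cW.
have H i := opposite_twist t0 (normal_unit (ak i)) (normal_unit (bl i))
    (normal_unit (cm i)) (normal_unit (W i)) C1n Cn (ab i) (ac i) (bW i) (cW i).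
have [a [x [_ _ ea ex E]]] := H 0.
have D0 : 1 - C1 ^+ 2 != 0 by rewrite subr_eq0 eq_sym.
have {}H i : point (cm i) - point (ak i) = a *: (point (bl i) - point (ak i)) /\
    normal (cm i) = (C2 - a * C1) *: normal (ak i) + a *: normal (bl i).
  have [a' [x' [h1 h2 ea' ex' E']]] := H i.
  have : a' ^+ 2 = a ^+ 2 by apply: (mulIf D0); rewrite ea ea'.
  move/eqP; rewrite eqf_sqr => /orP[/eqP <- //|/eqP e].
  case: (opposite_ratio C1n C2n ea ex ex' E).
  by rewrite -[RHS]E' e; ring.
have a0 : a != 0.
  apply: contraNneq C2n => a0; move: ea; rewrite a0 expr0n mul0r => /esym/eqP.
  by rewrite subr_eq0 eq_sym.
apply: (rigid_triple_not_generic (g := quad cm 0 j k) t0 C1n C12 a0 (gab 0 j k jk)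
  (fun r => ab _) (quad_common_sphere 0 j k a_pr) (quad_common_sphere 0 j k b_pr)
  (quad_common_sphere 0 j k c_pr)) => i'.
  exact: (proj1 (H _)).
exact: (proj2 (H _)).
Qed.

End Construction.
End FourthNet.

Unset Implicit Arguments.

Theorem theorem11 (R : realType) (s : nat) (s_ge2 : (2 <= s)%N)
    (ak bl cm : net R s) (tau : R)
    (ak_principal : principal ak)
    (ab_mates : baecklund_mates ak bl) (ac_mates : baecklund_mates ak cm)
    (ab_twist : net_twist ak bl tau) (ac_twist : net_twist ak cm tau)
    (distinct_constants :
       ~ exists delta phi : R, mates_with delta phi ak bl /\
                               mates_with delta phi ak cm)
    (a_curv : curvature_defined ak) (b_curv : curvature_defined bl)
    (c_curv : curvature_defined cm)
    (ab_generic : generic_mates ak bl) (ac_generic : generic_mates ak cm) :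
  exists dn : net R s,
    fourth_net ak bl cm dn /\
    (forall dn' : net R s, fourth_net ak bl cm dn' ->
       generic_mates bl dn' -> generic_mates cm dn' -> same_net dn dn').
Proof.
have [_ b_pr [d1 [p1 ab1]]] := ab_mates; have [_ c_pr [d2 [p2 ac2]]] := ac_mates.
have [d1_gt0 s1 ab] := mates_with_net_mated ab1.
have [d2_gt0 s2 ac] := mates_with_net_mated ac2.
have e1 : tau = sin p1 / d1 := mated_twist d1_gt0 s1 (ab1 0) (ab_twist 0).
have e2 : tau = sin p2 / d2 := mated_twist d2_gt0 s2 (ac2 0) (ac_twist 0).
have t0 : tau != 0 by rewrite e1 mulf_neq0 // invr_eq0 lt0r_neq0.
rewrite -e1 in ab; rewrite -e2 in ac.
have C1n := cos_neq1 s1; have C2n := cos_neq1 s2.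
(* [mated] sees only the twist, here common, and the cosine; with equal cosines, [d1] and [p1] would
   serve both transforms. *)
have C12 : cos p1 != cos p2.
  apply/eqP => e; apply: distinct_constants; exists d1, p1; split=> //.
  by apply: net_mated_mates_with; rewrite // -e1 e.
have [bd cd] := fourth_mated_both t0 C12 ab ac.
have d_pr := fourth_principal t0 C1n C2n C12 ab ac ak_principal b_pr c_pr.
exists (fourth t0 C12 ab ac); split.
  split; last exact: fourth_not_same.
  - split=> //; exists d2, p2.
    by apply: net_mated_mates_with; rewrite // -e2.
  - split=> //; exists d1, p1.
    by apply: net_mated_mates_with; rewrite // -e1.
move=> W [[_ W_pr [d3 [p3 /mates_with_net_mated[d3_gt0 s3 bW]]]]
  [_ _ [d4 [p4 /mates_with_net_mated[d4_gt0 s4 cW]]]] aW] gbW gcW.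
move: bW cW; set t3 := sin p3 / d3; set t4 := sin p4 / d4 => bW cW.
have t30 : t3 != 0 by rewrite mulf_neq0 // invr_eq0 lt0r_neq0.
have t40 : t4 != 0 by rewrite mulf_neq0 // invr_eq0 lt0r_neq0.
have C3n := cos_neq1 s3; have C4n := cos_neq1 s4.
have /eqP := net_twist_determined s_ge2 t0 C1n t30 C3n ak_principal b_pr W_pr
  ab bW b_curv ab_generic gbW.
have /eqP := net_twist_determined s_ge2 t0 C2n t40 C4n ak_principal c_pr W_pr
  ac cW c_curv ac_generic gcW.
have bV := net_mated_reverse bW; have cV := net_mated_reverse cW.
have no_opposite C C' (V : net R s) : C ^+ 2 != 1 -> net_mated tau C bl V ->
    net_mated (- tau) C' cm V -> False.
  move=> Cn; exact: (no_opposite_transform t0 C1n C2n C12 ab ac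
    ak_principal b_pr c_pr s_ge2 Cn ab_generic).
have N3n : (- cos p3) ^+ 2 != 1 by rewrite sqrrN.
(* For two positive signs [W] itself has twist [tau], for two negative ones its reversal; mixed
   signs are impossible. *)
rewrite !eqf_sqr => /orP[/eqP e4|/eqP e4] /orP[/eqP e3|/eqP e3].
- rewrite -e3 in bW; rewrite -e4 in cW.
  have [|h] := fourth_net_unique t0 C12 ab ac bW cW; first by move=> h; case: aW; left.
  by left.
- rewrite -e3 in bV; rewrite -e4 in cV.
  by case: (no_opposite _ _ _ N3n bV cV).
- rewrite -e3 in bW; rewrite -[t4]opprK -e4 in cW.
  by case: (no_opposite _ _ _ C3n bW cW).
rewrite -e3 in bV; rewrite -e4 in cV.
have reverseK (e f : contact_element R) : reverse e = f -> e = reverse f.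
  by move=> <-; apply: contact_element_eq; rewrite //= opprK.
have [h|h] := fourth_net_unique t0 C12 ab ac bV cV.
  by case: aW; right=> i; apply: reverseK.
by right=> i; apply: reverseK.
Qed.
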